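(* Fix $\eta>0$ and constants $a\ge0$, $c>0$. There exist constants $b,K,\kappa>0$, depending only on $\eta,a,c$, such that the following holds. Let $d\ge2$ and $\mathcal{T}\geq 1$ be integers and let $\bm{t}_1,\dots,\bm{t}_{\mathcal{T}}$ and $\bm{o}_1,\dots,\bm{o}_{\mathcal{T}}$ be sequences of vectors in $\Delta([d])$ (target vectors and associated returns vectors) with $$\langle \bm{t}_i,\bm{o}_j\rangle\geq c\,d^{-a}\ \text{ for all } j<i,\qquad \langle\bm{t}_i,\bm{o}_i\rangle=0\ \text{ for all } i.$$ Then for every $T>K(\mathcal{T}d)^b$, the regret of the LB-FTRL algorithm with parameter $\eta$ against the sequence of returns vectors $r_1,\dots,r_T$ generated by the procedure described in the context satisfies $$\mathrm{Reg}=\max_{u\in\Delta([d])}\sum_{t=1}^T\big(f_t(x_t)-f_t(u)\big)\geq \kappa\,\mathcal{T}\log(T)\log\log(T).$$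
   Context: Online portfolio problem: $\Delta([d])$ is the probability simplex in $\mathbb{R}^d$. In round $t$ the learner plays $x_t\in\Delta([d])$, then receives $r_t\in\Delta([d])$ and suffers $f_t(x_t)$, where $f_t(x)=-\log\langle x,r_t\rangle$. LB-FTRL with parameter $\eta>0$ plays $x_t=\arg\min_{x\in\Delta([d])}\Phi_{t}(x)$, where $\Phi_t(x)=\eta^{-1}R(x)+\sum_{\tau=1}^{t-1}f_\tau(x)$ and $R(x)=-\sum_{i=1}^d\log(x_i)$. Notation: $\bm{c}=\frac1d\mathbf{1}_d$. Let $V\in\mathbb{R}^{d\times(d-1)}$ have columns forming an orthonormal basis of the orthogonal complement of $\bm c$; $\Pi x=V^\top x\in\mathbb{R}^{d-1}$ for $x\in\mathbb{R}^d$, and $\Pi^{-1}v=Vv+\bm{c}$ for $v\in\mathbb{R}^{d-1}$. Let $\alpha=\frac18$, $c_s=1-2^sT^{-\alpha}$, and for $\bm{x}\in\Delta([d])$ let $\bm{x}^{(s)}=c_s\bm{x}+(1-c_s)\bm{c}$. Procedure generating the returns (given $\bm t_i,\bm o_i$ and $T$; it depends on the iterates $x_t$ of the deterministic algorithm LB-FTRL). Start with $t=1$. For $i=1,\dots,\mathcal{T}$; for $k=1,\dots,\lfloor T^\alpha\rfloor$; for $s=1,\dots,\lfloor\frac13\alpha\log_2(T)\rfloor$ do: (i) while $x_t\neq\bm{t}_i^{(s)}$, set $r_t=\text{move}(\bm{t}_i^{(s)};\Phi_t)$ and $t\leftarrow t+1$; (ii) then set $r_t=\bm{o}_i^{(s)}$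 and $t\leftarrow t+1$. Here $\text{move}(x;\Phi)$ is defined as follows: let $g=\Pi\nabla\Phi(x)$ and return $\Pi^{-1}(\lambda g)$ with $$\lambda=\min\Big\{\frac{T^{-1/2}}{\|g\|_2},\ \frac{1}{d\max\{1-\langle g,\Pi x\rangle,0\}}\Big\}$$ (with $1/0=\infty$). If the loops finish before round $T$, all remaining returns are $r_t=\bm{c}$ (which gives a constant loss). *)

(* Defs.v *)
From HB Require Import structures.
From mathcomp Require Import all_boot all_order all_algebra.
From mathcomp Require Import all_classical all_reals all_analysis.
Set Implicit Arguments.
Unset Strict Implicit.
Unset Printing Implicit Defensive.
Import Order.TTheory GRing.Theory Num.Theory.
Import numFieldNormedType.Exports.

Local Open Scope classical_set_scope.
Local Open Scope ring_scope.

Definition dot (R : realType) (n : nat) (u v : 'cV[R]_n) : R :=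
  \sum_(i < n) u i 0 * v i 0.

(* The library norm on matrices is the sup norm, hence this separate one. *)
Definition norm2 (R : realType) (n : nat) (u : 'cV[R]_n) : R :=
  Num.sqrt (dot u u).

Definition simplex (R : realType) (d : nat) : set 'cV[R]_d :=
  [set x | (forall i, 0 <= x i 0) /\ \sum_(i < d) x i 0 = 1].

Definition centroid (R : realType) (d : nat) : 'cV[R]_d := const_mx d%:R^-1.

Definition gradient (R : realType) (d : nat) (F : 'cV[R]_d -> R) (x : 'cV[R]_d) :
    'cV[R]_d :=
  \col_i ('D_(delta_mx i 0) F x).

(* Losses take values in [\bar R]: [lne] is [-oo] on nonpositive arguments, so
   that the loss is [+oo] when the return is orthogonal to the portfolio (the
   real logarithm [ln] would give [0] there). *)
Definition loss (R : realType) (d : nat) (r x : 'cV[R]_d) : \bar R :=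
  (- lne (dot x r)%:E)%E.

Definition log_barrier (R : realType) (d : nat) (x : 'cV[R]_d) : \bar R :=
  (- \sum_(i < d) lne (x i 0)%:E)%E.

(* [rs] lists the returns of the past rounds, oldest first. *)
Definition potential (R : realType) (d : nat) (eta : R) (rs : seq 'cV[R]_d)
    (x : 'cV[R]_d) : \bar R :=
  ((eta^-1)%:E * log_barrier x + \sum_(r <- rs) loss r x)%E.

(* For [F := potential eta rs] with [0 < eta], [0 < d] and [rs] in the simplex,
   the minimizer exists and is unique (strict convexity of the log-barrier);
   [centroid] is a default value for the other cases. *)
Definition argmin_simplex (R : realType) (d : nat) (F : 'cV[R]_d -> \bar R) :
    'cV[R]_d :=
  xget (centroid R d)
    [set x | simplex x /\ forall y, simplex y -> (F x <= F y)%E].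

Definition lb_ftrl (R : realType) (d : nat) (eta : R) (rs : seq 'cV[R]_d) :
    'cV[R]_d :=
  argmin_simplex (potential eta rs).

(* The portfolio of round [t] only depends on the returns of the rounds before
   [t]. The supremum is a maximum whenever the returns are in the simplex: each
   summand is then an upper semicontinuous function of [u]. *)
Definition regret (R : realType) (d : nat) (eta : R) (rs : seq 'cV[R]_d) :
    \bar R :=
  ereal_sup [set (\sum_(t < size rs)
      (loss rs`_t (lb_ftrl eta (take t rs)) - loss rs`_t u))%E
    | u in @simplex R d].

Definition orthonormal_basis_centroid_compl (R : realType) (d : nat)
    (V : 'M[R]_(d, d.-1)) : Prop :=
  V^T *m V = 1%:M /\ (V^T :=: kermx (centroid R d))%MS.

Definition compl_proj (R : realType) (d : nat) (V : 'M[R]_(d, d.-1)) (x : 'cV[R]_d) :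
    'cV[R]_d.-1 :=
  V^T *m x.

Definition compl_unproj (R : realType) (d : nat) (V : 'M[R]_(d, d.-1))
    (v : 'cV[R]_d.-1) : 'cV[R]_d :=
  V *m v + centroid R d.

Definition alpha (R : realType) : R := 8%:R^-1.

Definition mix_coef (R : realType) (T s : nat) : R :=
  1 - 2 ^+ s * T%:R `^ (- alpha R).

Definition mix (R : realType) (d T s : nat) (x : 'cV[R]_d) : 'cV[R]_d :=
  mix_coef R T s *: x + (1 - mix_coef R T s) *: centroid R d.

(* [1 / 0 = +oo] for the division of [\bar R]. The minimum is always finite: its
   second argument is [+oo] only if [g != 0]. [fine] makes the potential
   real-valued, which does not change it near a point with positive coordinates
   when the returns are in the simplex; [x] has positive coordinates below. *)
Definition move (R : realType) (d T : nat) (V : 'M[R]_(d, d.-1))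
    (x : 'cV[R]_d) (Phi : 'cV[R]_d -> \bar R) : 'cV[R]_d :=
  let g := compl_proj V (gradient (fine \o Phi) x) in
  let lambda := fine (Order.min
    ((T%:R `^ (- 2^-1))%:E / (norm2 g)%:E)%E
    (1 / (d%:R * Num.max (1 - dot g (compl_proj V x)) 0)%:E)%E) in
  compl_unproj V (lambda *: g).

(* The pairs [(i, s)] met by the three nested loops, in order; the pairs of one
   pass of the loop on [s] are repeated for each [k]. *)
Definition schedule (R : realType) (N T : nat) : seq ('I_N * nat) :=
  flatten [seq [seq (i, s)
      | k <- iota 1 (Num.truncn (T%:R `^ alpha R)),
        s <- iota 1 (Num.truncn (3^-1 * alpha R * (ln T%:R / ln 2)))]
    | i <- enum 'I_N].

(* One round: from the past returns and the remaining schedule, the next return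
   and the new remaining schedule. A [while] loop is one schedule entry that is
   kept until the iterate hits the target. *)
Definition next_return (R : realType) (d N T : nat) (eta : R)
    (V : 'M[R]_(d, d.-1)) (tgt orc : 'I_N -> 'cV[R]_d)
    (rs : seq 'cV[R]_d) (todo : seq ('I_N * nat)) :
    'cV[R]_d * seq ('I_N * nat) :=
  if todo is (i, s) :: todo' then
    if lb_ftrl eta rs == mix T s (tgt i) then (mix T s (orc i), todo')
    else (move T V (mix T s (tgt i)) (potential eta rs), todo)
  else (centroid R d, [::]).

Fixpoint procedure (R : realType) (d N T : nat) (eta : R)
    (V : 'M[R]_(d, d.-1)) (tgt orc : 'I_N -> 'cV[R]_d) (t : nat) :
    seq 'cV[R]_d * seq ('I_N * nat) :=
  if t is t'.+1 then
    let: (rs, todo) := procedure T eta V tgt orc t' in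
    let: (r, todo') := next_return T eta V tgt orc rs todo in
    (rcons rs r, todo')
  else ([::], schedule R N T).

(* The returns of the rounds [1, ..., T]; the loops are cut off at round [T]. *)
Definition generated_returns (R : realType) (d N T : nat) (eta : R)
    (V : 'M[R]_(d, d.-1)) (tgt orc : 'I_N -> 'cV[R]_d) : seq 'cV[R]_d :=
  (procedure T eta V tgt orc T).1.

(* Main.v *)
Require Import Defs.
From HB Require Import structures.
From mathcomp Require Import all_boot all_order all_algebra.
From mathcomp Require Import all_classical all_reals all_analysis.
From mathcomp Require Import ring lra zify.
Set Implicit Arguments.
Unset Strict Implicit.
Unset Printing Implicit Defensive.
Import Order.TTheory GRing.Theory Num.Theory.
Import numFieldNormedType.Exports.

Local Open Scope classical_set_scope.
Local Open Scope ring_scope.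

(* Comparing with the last iterate, the regret of FTRL is at least the sum over
   the rounds of Phi_{t+1}(x_t) - min Phi_{t+1}, and every summand is nonnegative.

   The oracle round of (i, k, s) contributes of order 1 / ((k + d / eta) s). Write
   eps = 2^s T^(-1/8) and move the portfolio from t_i^(s) towards the centroid by
   the fraction rho * eps of the segment: <., o_i^(s)> grows by the relative
   amount of order rho, the slope of Phi_t vanishes, and the second order term
   is at most twice the sum of the squared relative changes in all logarithms. The
   earlier returns o_i^(s') contribute O(k s rho^2), those with s' > s being
   geometrically damped; the regularizer contributes d rho^2 / eta; the returns
   o_j^(s') with j < i and the moves contribute O(rho^2). Take rho of order
   1 / ((k + d / eta) s). The double sum over k and s is of order
   log T * log log T, for each of the N targets.

   All oracle rounds do take place before round T: a move either makes the
   projected gradient at the target vanish or shortens it by T^(-1/2), and at the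
   start of a while loop this gradient is small, since the past moves cancelled
   the other terms at the previous target and their sum hardly depends on the
   point. The bookkeeping is in powers of p = T^(1/48). *)

(** * Inner product and simplex *)

Section VectorFacts.
Context {R : realType}.
Implicit Types (w : R).

Lemma ln1D_lt w : -1 < w -> w != 0 -> ln (1 + w) < w.
Proof.
move=> w1 w0; have w1' : 0 < 1 + w by lra.
by rewrite -ltr_expR lnK ?posrE// expR_gt1Dx.
Qed.

(** From [ln (1 + u) <= u] at u = - w / (1 + w): [ln (1 + w)] is at least w / (1 + w) = w - w^2 / (1
    + w), and 1 + w is at least 1/2. *)
Lemma ln1D_ge w : - 2^-1 <= w -> w - 2 * w ^+ 2 <= ln (1 + w).
Proof.
move=> hw; have w1 : 0 < 1 + w by lra.
have -> : 1 + w = (1 + - (w / (1 + w)))^-1 by field; apply/andP; split; lra.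
have lt1 : w / (1 + w) < 1 by rewrite ltr_pdivrMr//; lra.
rewrite lnV ?posrE; last by lra.
rewrite lerNr; apply: (le_trans (le_ln1Dx _)); first by lra.
rewrite lerN2 ler_pdivlMr//.
have : 0 <= w ^+ 2 by exact: sqr_ge0.
rewrite !expr2 => ww; nra.
Qed.

Section Dim.
Context {d : nat}.
Implicit Types (u v x y z r : 'cV[R]_d) (a b k : R).

Lemma dotC u v : dot u v = dot v u.
Proof. by rewrite /dot; apply: eq_bigr => i _; rewrite mulrC. Qed.

Lemma dotDl u v r : dot (u + v) r = dot u r + dot v r.
Proof. by rewrite /dot -big_split/=; apply: eq_bigr => i _; rewrite mxE mulrDl. Qed.

Lemma dotZl k u v : dot (k *: u) v = k * dot u v.
Proof. by rewrite /dot mulr_sumr; apply: eq_bigr => i _; rewrite mxE mulrA. Qed.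

Lemma dotNl u v : dot (- u) v = - dot u v.
Proof. by rewrite -scaleN1r dotZl mulN1r. Qed.

Lemma dotBl u v r : dot (u - v) r = dot u r - dot v r.
Proof. by rewrite dotDl dotNl. Qed.

Lemma dotDr u v r : dot r (u + v) = dot r u + dot r v.
Proof. by rewrite dotC dotDl !(dotC _ r). Qed.

Lemma dotZr k u v : dot u (k *: v) = k * dot u v.
Proof. by rewrite dotC dotZl dotC. Qed.

Lemma dotBr u v r : dot r (u - v) = dot r u - dot r v.
Proof. by rewrite dotC dotBl !(dotC _ r). Qed.

Lemma dot_ge0 u : 0 <= dot u u.
Proof. by apply: sumr_ge0 => i _; rewrite -expr2 sqr_ge0. Qed.

Lemma norm2_ge0 u : 0 <= norm2 u.
Proof. exact: sqrtr_ge0. Qed.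

Lemma norm2_sqr u : norm2 u ^+ 2 = dot u u.
Proof. by rewrite /norm2 sqr_sqrtr// dot_ge0. Qed.

Lemma norm2Z k u : 0 <= k -> norm2 (k *: u) = k * norm2 u.
Proof.
by move=> k0; rewrite /norm2 dotZl dotZr mulrA -expr2 sqrtrM ?sqr_ge0// sqrtr_sqr ger0_norm.
Qed.

Lemma norm2_eq0 u : norm2 u = 0 -> u = 0.
Proof.
move=> u0; have : dot u u = 0 by rewrite -norm2_sqr u0 expr0n.
move=> /eqP; rewrite psumr_eq0; last by move=> i _; rewrite -expr2 sqr_ge0.
move=> /allP h; apply/colP => i; rewrite mxE.
by have := h i (mem_index_enum _); rewrite mulf_eq0 orbb => /eqP.
Qed.

Lemma norm2_gt0 u : u != 0 -> 0 < norm2 u.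
Proof.
move=> u0; rewrite lt_neqAle norm2_ge0 andbT eq_sym.
by apply/eqP => /norm2_eq0/eqP; rewrite (negbTE u0).
Qed.

Lemma cauchy_schwarz u v : `|dot u v| <= norm2 u * norm2 v.
Proof.
rewrite -(ler_sqr (x := `|_|)) ?nnegrE ?mulr_ge0 ?norm2_ge0//.
rewrite exprMn !norm2_sqr real_normK ?num_real//.
have [->|v0] := eqVneq v 0.
  by rewrite -(scale0r 0) !dotZr !mul0r expr0n mulr0.
have vv : 0 < dot v v by rewrite -norm2_sqr exprn_gt0// norm2_gt0.
have := dot_ge0 (dot v v *: u - dot u v *: v).
rewrite !dotBl !dotBr !dotZl !dotZr (dotC v u) => h.
have : 0 <= dot v v * (dot u u * dot v v - dot u v ^+ 2).
  by move: h; rewrite expr2; congr (_ <= _); ring.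
by rewrite pmulr_rge0// subr_ge0.
Qed.

Lemma coord_le_norm2 u i : `|u i 0| <= norm2 u.
Proof.
rewrite -(ler_sqr (x := `|_|)) ?nnegrE ?norm2_ge0// norm2_sqr.
rewrite real_normK ?num_real// /dot (bigD1 i)//= expr2 lerDl.
by apply: sumr_ge0 => j _; rewrite -expr2 sqr_ge0.
Qed.

Lemma simplex_le1 x i : simplex x -> x i 0 <= 1.
Proof.
move=> [x0 <-]; rewrite (bigD1 i)//= lerDl.
by apply: sumr_ge0 => j _.
Qed.

Lemma simplex_norm2_le1 x : simplex x -> norm2 x <= 1.
Proof.
move=> xs; rewrite -(ler_sqr (x := norm2 _)) ?nnegrE ?norm2_ge0// norm2_sqr.
have [x0 x1] := xs; rewrite expr1n -[leRHS]x1; apply: ler_sum => i _.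
by rewrite ler_piMr// simplex_le1.
Qed.

Lemma dot_simplex_ge0 x r : simplex x -> simplex r -> 0 <= dot x r.
Proof. by move=> [x0 _] [r0 _]; apply: sumr_ge0 => i _; rewrite mulr_ge0. Qed.

Lemma dot_simplex_le1 x r : simplex x -> simplex r -> dot x r <= 1.
Proof.
move=> xs [r0 <-]; apply: ler_sum => i _.
by rewrite ler_piMl// simplex_le1.
Qed.

Lemma dot_simplex_ge k x r :
  (forall i, k <= x i 0) -> simplex r -> k <= dot x r.
Proof.
move=> xk [r0 r1]; rewrite -[leLHS]mulr1 -r1 mulr_sumr.
by apply: ler_sum => i _; rewrite ler_wpM2r.
Qed.

Lemma dot_pos_gt0 x r : (forall i, 0 < x i 0) -> simplex r -> 0 < dot x r.
Proof.
move=> x0 [r0 r1].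
have xr0 i : 0 <= x i 0 * r i 0 by rewrite mulr_ge0// ltW.
rewrite lt_neqAle sumr_ge0// andbT eq_sym psumr_eq0//.
apply/negP => /allP h; suff : (0 : R) = 1 by apply/eqP; rewrite eq_sym oner_eq0.
rewrite -r1 big1// => i _.
by have := h i (mem_index_enum _); rewrite mulf_eq0 gt_eqF//= => /eqP.
Qed.

Lemma simplex_convex k x y : 0 <= k <= 1 -> simplex x -> simplex y ->
  simplex (k *: x + (1 - k) *: y).
Proof.
move=> /andP[k0 k1] [x0 x1] [y0 y1]; split.
  by move=> i; rewrite !mxE addr_ge0 ?mulr_ge0// subr_ge0.
under eq_bigr do rewrite !mxE.
by rewrite big_split/= -!mulr_sumr x1 y1; lra.
Qed.

Lemma sum_sub_simplex x y : simplex x -> simplex y ->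
  \sum_(i < d) (y - x) i 0 = 0.
Proof.
move=> [_ x1] [_ y1]; under eq_bigr do rewrite !mxE.
by rewrite sumrB x1 y1 subrr.
Qed.

Lemma dotE u v : dot u v = (u^T *m v) 0 0.
Proof. by rewrite mxE; apply: eq_bigr => i _; rewrite mxE. Qed.

Hypothesis d_gt0 : (0 < d)%N.

Lemma centroid_simplex : simplex (centroid R d).
Proof.
split=> [i|]; first by rewrite mxE invr_ge0.
under eq_bigr do rewrite mxE.
by rewrite sumr_const card_ord -[_ *+ d]mulr_natr mulVf// pnatr_eq0 -lt0n.
Qed.

Lemma dot_centroidr x : dot x (centroid R d) = (\sum_(i < d) x i 0) / d%:R.
Proof. by rewrite /dot mulr_suml; apply: eq_bigr => i _; rewrite mxE. Qed.

Lemma dot_simplex_centroid x : simplex x -> dot x (centroid R d) = d%:R^-1.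
Proof. by move=> [_ x1]; rewrite dot_centroidr x1 mul1r. Qed.

Lemma dot_centroid_simplex x : simplex x -> dot (centroid R d) x = d%:R^-1.
Proof. by rewrite dotC; exact: dot_simplex_centroid. Qed.

(** On the simplex the product with the centroid is the constant 1/d, so only the deviation of [r]
    from the centroid counts. *)
Lemma dot_close_le tau x r : norm2 (r - centroid R d) <= tau -> simplex x ->
  `|dot x r - d%:R^-1| <= tau.
Proof.
move=> hr xs; rewrite -(dot_simplex_centroid xs) -dotBr.
apply: le_trans (cauchy_schwarz _ _) _; rewrite -[leRHS]mul1r.
by rewrite ler_pM ?norm2_ge0// simplex_norm2_le1.
Qed.

End Dim.

Lemma dot_mulmxl (m n : nat) (A : 'M[R]_(m, n)) (h : 'cV[R]_n) (x : 'cV[R]_m) :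
  dot (A *m h) x = dot h (A^T *m x).
Proof. by rewrite !dotE trmx_mul mulmxA. Qed.

End VectorFacts.

(** * Potential and its minimizer *)

Section Potential.
Context {R : realType} {d : nat}.
Variable eta : R.
Hypotheses (eta_gt0 : 0 < eta) (d_gt0 : (0 < d)%N).
Implicit Types (x y z r : 'cV[R]_d) (rs : seq 'cV[R]_d).

Definition positive_vec x := forall i, 0 < x i 0.
Definition all_simplex rs := forall r, r \in rs -> simplex r.

(** Common shape of the quantities attached to the potential at [x] along [z]: [phi] receives the
    increment of the argument of each logarithm, then its base value. The main instances are a / b,
    (a / b)^2 and ln (1 + a / b). *)
Definition barrier_sum (phi : R -> R -> R) rs x z : R :=
  eta^-1 * \sum_(i < d) phi (z i 0) (x i 0) + \sum_(r <- rs) phi (dot z r) (dot x r).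

Definition real_potential rs x : R :=
  - (eta^-1 * \sum_(i < d) ln (x i 0) + \sum_(r <- rs) ln (dot x r)).

(* [- slope rs x z] is the derivative of the potential at [x] in direction [z]. *)
Definition slope rs x z := barrier_sum (fun a b => a / b) rs x z.

Lemma all_simplex_cons r rs : all_simplex (r :: rs) -> simplex r /\ all_simplex rs.
Proof.
move=> h; split; first by apply: h; rewrite mem_head.
by move=> q qrs; apply: h; rewrite in_cons qrs orbT.
Qed.

Lemma all_simplex_rcons r rs : simplex r -> all_simplex rs ->
  all_simplex (rcons rs r).
Proof. by move=> hr h q; rewrite mem_rcons in_cons => /orP[/eqP->//|/h]. Qed.

Lemma ereal_sum_lne (I : Type) (s : seq I) (f : I -> R) :
  (forall i, 0 < f i) -> (\sum_(i <- s) lne (f i)%:E = (\sum_(i <- s) ln (f i))%:E)%E.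
Proof. by move=> f0; rewrite -sumEFin; apply: eq_bigr => i _; rewrite lne_EFin. Qed.

Lemma lossE r x : positive_vec x -> simplex r -> loss r x = (- ln (dot x r))%:E.
Proof. by move=> x0 hr; rewrite /loss lne_EFin// dot_pos_gt0. Qed.

Lemma loss_ge0 r x : simplex x -> simplex r -> (0 <= loss r x)%E.
Proof. by move=> xs hr; rewrite /loss oppe_ge0 lne_le0 lee_fin dot_simplex_le1. Qed.

Lemma potentialE rs x : positive_vec x -> all_simplex rs ->
  potential eta rs x = (real_potential rs x)%:E.
Proof.
move=> x0 hrs; rewrite /potential /log_barrier ereal_sum_lne//.
have -> : (\sum_(r <- rs) loss r x = (- \sum_(r <- rs) ln (dot x r))%:E)%E.
  elim: rs hrs => [|r rs IH] hrs; first by rewrite !big_nil oppr0.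
  have [hr {}hrs] := all_simplex_cons hrs.
  by rewrite !big_cons IH// lossE// -EFinD opprD.
by rewrite -EFinN -EFinM -EFinD /real_potential mulrN opprD.
Qed.

(** A coordinate that is not positive makes the barrier [+oo], and the losses, nonnegative on the
    simplex, cannot cancel it. *)
Lemma potential_boundary rs x : simplex x -> all_simplex rs ->
  ~ positive_vec x -> potential eta rs x = +oo%E.
Proof.
move=> xs hrs xn.
have [i xi] : exists i, x i 0 <= 0.
  by apply: contrapT => h; apply: xn => i; rewrite ltNge; apply/negP => xi; apply: h; exists i.
have lnNy : (\sum_(j < d) lne (x j 0)%:E = -oo)%E.
  by apply/esum_eqNyP; exists i; rewrite mem_index_enum le0_lneNy ?lee_fin.
rewrite /potential /log_barrier lnNy.
rewrite gt0_muley ?lte_fin ?invr_gt0// addye// gt_eqF//.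
apply: (@lt_le_trans _ _ 0%E); first exact: ltNy0.
rewrite big_seq; apply: sume_ge0 => r rrs.
by apply: loss_ge0 => //; exact: hrs.
Qed.

(** Coordinates and inner products are at most 1 on the simplex, so every other term of the
    potential is nonnegative. *)
Lemma real_potential_ge rs x i : positive_vec x -> simplex x -> all_simplex rs ->
  - (eta^-1 * ln (x i 0)) <= real_potential rs x.
Proof.
move=> x0 xs hrs; rewrite /real_potential lerN2 (bigD1 i)//= mulrDr -addrA gerDl.
rewrite -[leRHS]addr0 lerD//.
  rewrite pmulr_rle0 ?invr_gt0//; apply: sumr_le0 => j _.
  by rewrite ln_le0// simplex_le1.
rewrite big_seq; apply: sumr_le0 => r rrs.
by rewrite ln_le0// dot_simplex_le1//; exact: hrs.
Qed.

Lemma positive_lower_bound x : positive_vec x -> exists2 m, 0 < m & forall i, m <= x i 0.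
Proof.
move=> x0; exists (\big[Order.min/1]_(i < d) x i 0).
  by elim/big_ind: _ => // a b a0 b0; rewrite lt_min a0.
by move=> i; rewrite (bigD1 i)//= ge_min lexx.
Qed.

(** Clipping at [e > 0] gives a function that is continuous on the whole space and, for returns in
    the simplex, equals the potential where all coordinates are at least [e]. The argument is a row
    vector to suit [rV_compact]. *)
Let clipped_potential rs e (v : 'rV[R]_d) : R :=
  - (eta^-1 * \sum_(i < d) ln (Num.max (v 0 i) e)
     + \sum_(r <- rs) ln (Num.max (dot v^T r) e)).

Lemma continuous_sum (T : topologicalType) (I : Type) (s : seq I) (f : I -> T -> R) :
  (forall i, continuous (f i)) -> continuous (fun v => \sum_(i <- s) f i v).
Proof.
move=> cf v; elim: s => [|i s IH].
  by rewrite (_ : (fun _ => _) = cst 0) ?funeqE => [|w]; [exact: cst_continuous|rewrite big_nil].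
rewrite (_ : (fun _ => _) = (fun w => f i w + \sum_(i <- s) f i w)).
  by apply: cvgD => //; exact: cf.
by apply/funext => w; rewrite big_cons.
Qed.

Lemma continuous_mull (T : topologicalType) k (f : T -> R) :
  continuous f -> continuous (fun v => k * f v).
Proof. by move=> cf v; apply: cvgM; [exact: cvg_cst|exact: cf]. Qed.

Lemma continuous_oppD (T : topologicalType) (f g : T -> R) :
  continuous f -> continuous g -> continuous (fun v => - (f v + g v)).
Proof. by move=> cf cg v; apply: cvgN; apply: cvgD; [exact: cf|exact: cg]. Qed.

Lemma continuous_ln_max (T : topologicalType) e (f : T -> R) :
  0 < e -> continuous f -> continuous (fun v => ln (Num.max (f v) e)).
Proof.
move=> e0 cf v.
have cmax : {for v, continuous (fun v => Num.max (f v) e)}.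
  by apply: (@continuous_max R T f (cst e) v); [exact: cf|exact: cst_continuous].
apply: (continuous_comp cmax).
by apply: continuous_ln; rewrite lt_max e0 orbT.
Qed.

Lemma continuous_clipped_potential rs e : 0 < e -> continuous (clipped_potential rs e).
Proof.
move=> e0.
have coord i : continuous (fun v : 'rV[R]_d => v 0 i) by exact: coord_continuous.
have cln : continuous (fun v : 'rV[R]_d => \sum_(i < d) ln (Num.max (v 0 i) e)).
  by apply: continuous_sum => i; exact: continuous_ln_max.
have cdot r : continuous (fun v : 'rV[R]_d => dot v^T r).
  rewrite (_ : (fun _ => _) = (fun v : 'rV[R]_d => \sum_(i < d) r i 0 * v 0 i)).
    by apply: continuous_sum => i; exact: continuous_mull.
  by apply/funext => v; apply: eq_bigr => i _; rewrite mxE mulrC.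
have clns : continuous (fun v : 'rV[R]_d => \sum_(r <- rs) ln (Num.max (dot v^T r) e)).
  by apply: continuous_sum => r; exact: continuous_ln_max.
have cbar := continuous_mull (k := eta^-1) cln.
exact: continuous_oppD.
Qed.

Lemma clipped_potentialE rs e x : all_simplex rs -> (forall i, e <= x i 0) ->
  clipped_potential rs e x^T = real_potential rs x.
Proof.
move=> hrs xe; congr (- (_ * _ + _)).
  by apply: eq_bigr => i _; rewrite mxE max_l.
rewrite big_seq [RHS]big_seq; apply: eq_bigr => r rrs.
by rewrite trmxK max_l//; apply: dot_simplex_ge => //; exact: hrs.
Qed.

(** The minimum is attained on the compact part of the simplex with coordinates at least [e];
    elsewhere one small coordinate alone lifts the potential to at least its value at the
    centroid. *)
Lemma potential_has_argmin rs : all_simplex rs -> exists x, [/\ simplex x, positive_vec x &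
  forall y, simplex y -> positive_vec y -> real_potential rs x <= real_potential rs y].
Proof.
move=> hrs.
have c0 : positive_vec (centroid R d) by move=> i; rewrite mxE invr_gt0 ltr0n.
pose B := real_potential rs (centroid R d).
(* The first bound keeps the centroid in the compact part; the second solves - eta^-1 ln e = [B]. *)
pose e := Num.min d%:R^-1 (expR (- (eta * B))).
have e0 : 0 < e by rewrite lt_min invr_gt0 ltr0n d_gt0 expR_gt0.
have eB : B <= - (eta^-1 * ln e).
  rewrite lerNr -(ler_pM2l eta_gt0) mulVKf ?gt_eqF// mulrN -ler_expR lnK ?posrE//.
  by rewrite ge_min lexx orbT.
have ec i : e <= centroid R d i 0 by rewrite mxE ge_min lexx.
pose A := [set v : 'rV[R]_d | forall i, `[e, 1]%classic (v 0 i)] `&`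
          [set v : 'rV[R]_d | \sum_(i < d) v 0 i = 1].
have A0 : A !=set0.
  exists (centroid R d)^T; split => [i|] /=.
    by rewrite in_itv/= mxE ec/= simplex_le1//; exact: centroid_simplex.
  by under eq_bigr do rewrite mxE; have [] := @centroid_simplex R d d_gt0.
have cA : compact A.
  apply: compact_closedI.
    by apply: (@rV_compact _ _ (fun=> `[e, 1]%classic)) => i; exact: segment_compact.
  apply: (@closed_comp _ _ (fun v : 'rV[R]_d => \sum_(i < d) v 0 i) [set 1]).
    by move=> v _; apply: continuous_sum => i; exact: coord_continuous.
  exact: closed_eq.
have cF := continuous_subspaceT (continuous_clipped_potential (rs := rs) e0).
have [v] := compact_EVT_min A0 cA (cF A).
rewrite inE => -[Av1 Av2] vmin.
have ve i : e <= v^T i 0 by rewrite mxE; have := Av1 i; rewrite /= in_itv/= => /andP[].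
have vpos : positive_vec v^T by move=> i; exact: lt_le_trans (ve i).
have vs : simplex v^T.
  by split=> [i|]; [exact: ltW|under eq_bigr do rewrite mxE].
have le_e y : simplex y -> (forall i, e <= y i 0) -> real_potential rs v^T <= real_potential rs y.
  move=> ys ye; rewrite -!(@clipped_potentialE _ e)// trmxK; apply: vmin; rewrite inE; split.
    by move=> i /=; rewrite in_itv/= mxE ye simplex_le1.
  by rewrite /=; under eq_bigr do rewrite mxE; case: ys.
exists v^T; split => // y ys y0.
have [ye|/existsNP[i /negP]] := pselect (forall i, e <= y i 0); first exact: le_e.
rewrite -ltNge => yie.
apply: le_trans (le_e _ (centroid_simplex d_gt0) ec) _.
apply: le_trans eB _; apply: le_trans (real_potential_ge i y0 ys hrs).
by rewrite lerN2 ler_pM2l ?invr_gt0// ler_ln ?posrE// ltW.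
Qed.

(** A minimizer exists, so the default value of [xget] does not occur; it has positive coordinates
    because the potential is [+oo] on the boundary. *)
Lemma lb_ftrlP rs : all_simplex rs -> [/\ simplex (lb_ftrl eta rs),
  positive_vec (lb_ftrl eta rs) &
  forall y, simplex y -> (potential eta rs (lb_ftrl eta rs) <= potential eta rs y)%E].
Proof.
move=> hrs; have [x [xs x0 xmin]] := potential_has_argmin hrs.
have : [set x | simplex x /\ forall y, simplex y ->
    (potential eta rs x <= potential eta rs y)%E] (lb_ftrl eta rs).
  rewrite /lb_ftrl /argmin_simplex; apply: xgetPex; exists x; split => // y ys.
  have [y0|y0] := pselect (positive_vec y).
    by rewrite !potentialE// lee_fin xmin.
  by rewrite (potential_boundary ys)// leey.
move=> [ls lmin]; split => //; apply: contrapT => l0.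
by have := lmin _ xs; rewrite potential_boundary// potentialE// leye_eq.
Qed.

Lemma lb_ftrl_min rs y : all_simplex rs -> simplex y -> positive_vec y ->
  real_potential rs (lb_ftrl eta rs) <= real_potential rs y.
Proof.
move=> hrs ys y0; have [ls l0 lmin] := lb_ftrlP hrs.
by have := lmin _ ys; rewrite !potentialE// lee_fin.
Qed.
Lemma barrier_sum_rcons phi r rs x z :
  barrier_sum phi (rcons rs r) x z = barrier_sum phi rs x z + phi (dot z r) (dot x r).
Proof. by rewrite /barrier_sum big_rcons/= addrA. Qed.

Lemma barrier_sum_le phi psi rs x z :
  (forall i, phi (z i 0) (x i 0) <= psi (z i 0) (x i 0)) ->
  (forall r, r \in rs -> phi (dot z r) (dot x r) <= psi (dot z r) (dot x r)) ->
  barrier_sum phi rs x z <= barrier_sum psi rs x z.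
Proof.
move=> h1 h2; apply: lerD; first by rewrite ler_pM2l ?invr_gt0// ler_sum.
by rewrite big_seq [leRHS]big_seq; apply: ler_sum.
Qed.

Lemma barrier_sum_comb (phi psi1 psi2 : R -> R -> R) k rs x z :
  (forall a b, phi a b = psi1 a b + k * psi2 a b) ->
  barrier_sum phi rs x z = barrier_sum psi1 rs x z + k * barrier_sum psi2 rs x z.
Proof.
move=> h; rewrite /barrier_sum.
under eq_bigr do rewrite h.
under [X in _ + X = _]eq_bigr do rewrite h.
by rewrite !big_split/= -!mulr_sumr; ring.
Qed.

Lemma barrier_sum_homog phi k l rs x z :
  (forall a b, phi (k * a) b = l * phi a b) ->
  barrier_sum phi rs x (k *: z) = l * barrier_sum phi rs x z.
Proof.
move=> h; rewrite /barrier_sum mulrDr mulrCA !mulr_sumr; congr (_ + _).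
  by apply: eq_bigr => i _; rewrite mxE h.
by apply: eq_bigr => r _; rewrite dotZl h.
Qed.

Lemma slopeZ k rs x z : slope rs x (k *: z) = k * slope rs x z.
Proof. by apply: barrier_sum_homog => a b; rewrite mulrA. Qed.

Lemma slopeN rs x z : slope rs x (- z) = - slope rs x z.
Proof. by rewrite -scaleN1r slopeZ mulN1r. Qed.

(** The quadratic form of the Hessian of the potential at [x]. *)
Definition sq_sum rs x z := barrier_sum (fun a b => (a / b) ^+ 2) rs x z.

Lemma sq_sum_ge0 rs x z : 0 <= sq_sum rs x z.
Proof.
apply: addr_ge0.
  apply: mulr_ge0; first by rewrite invr_ge0 ltW.
  by apply: sumr_ge0 => i _; exact: sqr_ge0.
by apply: sumr_ge0 => i _; exact: sqr_ge0.
Qed.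

Lemma sq_sumZ k rs x z : sq_sum rs x (k *: z) = k ^+ 2 * sq_sum rs x z.
Proof. by apply: barrier_sum_homog => a b; rewrite -mulrA exprMn. Qed.

Lemma real_potentialD rs x z : positive_vec x -> positive_vec (x + z) -> all_simplex rs ->
  real_potential rs (x + z) =
  real_potential rs x - barrier_sum (fun a b => ln (1 + a / b)) rs x z.
Proof.
move=> x0 xz0 hrs.
have lnD (a b : R) : 0 < b -> 0 < b + a -> ln (b + a) = ln b + ln (1 + a / b).
  move=> b0 ba0; rewrite -lnM ?posrE//.
    by congr ln; field; exact: lt0r_neq0.
  by rewrite -(ltr_pM2l b0) mulr0 mulrDr mulr1 mulrCA divff ?mulr1// lt0r_neq0.
rewrite /real_potential /barrier_sum.
have -> : \sum_(i < d) ln ((x + z) i 0) =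
    \sum_(i < d) ln (x i 0) + \sum_(i < d) ln (1 + z i 0 / x i 0).
  rewrite -big_split/=; apply: eq_bigr => i _.
  by have := xz0 i; rewrite mxE => xzi; rewrite lnD.
have -> : \sum_(r <- rs) ln (dot (x + z) r) =
    \sum_(r <- rs) ln (dot x r) + \sum_(r <- rs) ln (1 + dot z r / dot x r).
  rewrite -big_split/= big_seq [RHS]big_seq; apply: eq_bigr => r rrs.
  have := dot_pos_gt0 xz0 (hrs _ rrs); rewrite dotDl => xzr.
  by rewrite lnD// dot_pos_gt0//; exact: hrs.
by ring.
Qed.

Lemma dot_abs_le k x z r : (forall i, `|z i 0| <= k * x i 0) -> simplex r ->
  `|dot z r| <= k * dot x r.
Proof.
move=> zx [r0 _]; rewrite /dot mulr_sumr; apply: le_trans (ler_norm_sum _ _ _) _.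
by apply: ler_sum => i _; rewrite normrM (ger0_norm (r0 i)) mulrA ler_wpM2r.
Qed.

(** This is [ln1D_ge] for every logarithm. A bound on the coordinates of [z] relative to [x]
    suffices, since inner products with nonnegative vectors inherit it. *)
Lemma real_potential_ub rs x z : positive_vec x -> all_simplex rs ->
  (forall i, `|z i 0| <= 2^-1 * x i 0) ->
  positive_vec (x + z) /\
  real_potential rs (x + z) <= real_potential rs x - slope rs x z + 2 * sq_sum rs x z.
Proof.
move=> x0 hrs zx; have xz0 : positive_vec (x + z).
  by move=> i; have := zx i; have := x0 i; rewrite mxE ler_norml => ? /andP[? _]; lra.
split => //; rewrite real_potentialD// -addrA lerD2l.
rewrite lerNl opprD opprK -mulNr /slope /sq_sum.
rewrite -(barrier_sum_comb (phi := fun a b => a / b - 2 * (a / b) ^+ 2)); last first.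
  by move=> a b; rewrite mulNr.
have ge (a b : R) : 0 < b -> `|a| <= 2^-1 * b -> a / b - 2 * (a / b) ^+ 2 <= ln (1 + a / b).
  move=> b0; rewrite ler_norml => /andP[ab _]; apply: ln1D_ge.
  by rewrite ler_pdivlMr// mulNr.
apply: barrier_sum_le => [i|r rrs]; first by apply: ge.
have hr := hrs _ rrs; apply: ge; first exact: dot_pos_gt0.
exact: dot_abs_le.
Qed.

(** A positive slope would let a small step along [z] lower the potential below its minimum. *)
Lemma slope_lb_ftrl_le0 rs z : all_simplex rs -> \sum_(i < d) z i 0 = 0 ->
  slope rs (lb_ftrl eta rs) z <= 0.
Proof.
move=> hrs z0; have [xs x0 _] := lb_ftrlP hrs; set x := lb_ftrl eta rs in xs x0 *.
rewrite leNgt; apply/negP => s0.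
have [m m0 mx] := positive_lower_bound x0.
have Q0 := sq_sum_ge0 rs x z; have n0 := norm2_ge0 z.
(* The first bound keeps the relative change of each coordinate at most 1/2; the second makes the
   quadratic term at most half of the linear one. The [+ 1] keep the denominators positive. *)
pose k := Num.min (m / (2 * (norm2 z + 1))) (slope rs x z / (4 * (sq_sum rs x z + 1))).
have k0 : 0 < k by rewrite lt_min !divr_gt0//; lra.
have k1 : k * (2 * (norm2 z + 1)) <= m.
  by rewrite -ler_pdivlMr ?ge_min ?lexx//; lra.
have k2 : k * (4 * (sq_sum rs x z + 1)) <= slope rs x z.
  by rewrite -ler_pdivlMr ?ge_min ?lexx ?orbT//; lra.
have [i|xz0 ub] := @real_potential_ub rs x (k *: z) x0 hrs.
  rewrite mxE normrM gtr0_norm//; have := coord_le_norm2 z i; have := mx i => xi zi.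
  have : k * `|z i 0| <= k * norm2 z by rewrite ler_pM2l.
  move: k1; rewrite !mulrDr; lra.
have xzs : simplex (x + k *: z).
  split=> [i|]; first exact: ltW.
  under eq_bigr do rewrite mxE; rewrite big_split/=.
  under [X in _ + X]eq_bigr do rewrite mxE.
  by rewrite -mulr_sumr z0 mulr0 addr0; case: xs.
have := lb_ftrl_min hrs xzs xz0; rewrite leNgt => /negP; apply.
apply: le_lt_trans ub _; rewrite slopeZ sq_sumZ -addrA gtrDl.
nra.
Qed.

Lemma slope_lb_ftrl rs z : all_simplex rs -> \sum_(i < d) z i 0 = 0 ->
  slope rs (lb_ftrl eta rs) z = 0.
Proof.
move=> hrs z0; apply/eqP; rewrite eq_le slope_lb_ftrl_le0//= -oppr_le0 -slopeN.
apply: slope_lb_ftrl_le0 => //; under eq_bigr do rewrite mxE.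
by rewrite sumrN z0 oppr0.
Qed.

(** For the minimizer y = x + z, minimality and the zero slope along [z] give a sum of terms w - ln
    (1 + w) that is at most 0. Each term is nonnegative and vanishes only for w = 0, hence z = 0. *)
Lemma lb_ftrl_unique rs x : all_simplex rs -> simplex x -> positive_vec x ->
  (forall z, \sum_(i < d) z i 0 = 0 -> slope rs x z = 0) -> lb_ftrl eta rs = x.
Proof.
move=> hrs xs x0 st; have [ys y0 _] := lb_ftrlP hrs.
have := lb_ftrl_min hrs xs x0; set y := lb_ftrl eta rs in ys y0 *.
pose z := y - x; have yE : y = x + z by rewrite addrC subrK.
have z0 : \sum_(i < d) z i 0 = 0 by exact: sum_sub_simplex.
have xz0 : positive_vec (x + z) by rewrite -yE.
rewrite yE real_potentialD// gerDl oppr_le0 => L0.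
pose phi (a b : R) := a / b - ln (1 + a / b).
have w1 (a b : R) : 0 < b -> 0 < b + a -> -1 < a / b.
  by move=> b0 ba0; rewrite ltr_pdivlMr//; lra.
have phi0 (a b : R) : 0 < b -> 0 < b + a -> 0 <= phi a b.
  by move=> b0 ba0; rewrite subr_ge0 le_ln1Dx// w1.
have : barrier_sum phi rs x z <= 0.
  rewrite (@barrier_sum_comb _ (fun a b => a / b) (fun a b => ln (1 + a / b)) (-1)).
    by rewrite [X in X + _](st _ z0); lra.
  by move=> a b; rewrite mulN1r.
have xzi i : 0 < x i 0 + z i 0 by have := xz0 i; rewrite mxE.
have S1 : 0 <= \sum_(i < d) phi (z i 0) (x i 0) by apply: sumr_ge0 => i _; exact: phi0.
have S2 : 0 <= \sum_(r <- rs) phi (dot z r) (dot x r).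
  rewrite big_seq; apply: sumr_ge0 => r /hrs hr; apply: phi0; first exact: dot_pos_gt0.
  by rewrite -dotDl dot_pos_gt0.
move=> le0; have : \sum_(i < d) phi (z i 0) (x i 0) = 0.
  apply/eqP; rewrite eq_le S1 andbT.
  by rewrite -(@pmulr_rle0 _ eta^-1) ?invr_gt0//; move: le0; rewrite /barrier_sum; lra.
move=> /eqP; rewrite psumr_eq0; last by move=> i _; exact: phi0.
move=> /allP zz; suff -> : z = 0 by rewrite addr0.
apply/colP => i; rewrite [RHS]mxE.
have := zz i (mem_index_enum _); rewrite /= subr_eq0 => /eqP zi.
have [//|zi0] := eqVneq (z i 0) 0.
have : z i 0 / x i 0 != 0 by rewrite mulf_neq0// invr_neq0// lt0r_neq0.
by move=> /(ln1D_lt (w1 _ _ (x0 i) (xzi i))); rewrite -zi ltxx.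
Qed.

End Potential.

(** * Gradient and moves *)

Section Gradient.
Context {R : realType} {d : nat}.
Variable eta : R.
Hypotheses (eta_gt0 : 0 < eta) (d_gt0 : (0 < d)%N).
Implicit Types (x y z r : 'cV[R]_d) (rs : seq 'cV[R]_d).

Lemma derive_line (F : 'cV[R]_d -> R) x z :
  'D_z F x = 'D_1 (fun h : R => F (h *: z + x)) 0.
Proof.
rewrite /derive; set g1 := fun h => h^-1 *: _; set g2 := fun h => h^-1 *: _.
suff -> : g1 = g2 by [].
by rewrite funeqE /g1 /g2 => h /=; rewrite addr0 scale0r add0r [_%:A]mulr1.
Qed.

Lemma is_derive_big_sum (I : eqType) (s : seq I) (f : I -> R -> R) (df : I -> R) (h : R) :
  (forall i, i \in s -> is_derive h 1 (f i) (df i)) ->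
  is_derive h 1 (fun k => \sum_(i <- s) f i k) (\sum_(i <- s) df i).
Proof.
move=> fd; elim: s fd => [|i s IH] fd.
  rewrite big_nil (_ : (fun _ => _) = cst 0); first exact: is_derive_cst.
  by apply/funext => k; rewrite big_nil.
rewrite big_cons (_ : (fun _ => _) = f i + (fun k => \sum_(i <- s) f i k)).
  apply: is_deriveD; first by apply: fd; rewrite mem_head.
  by apply: IH => j js; apply: fd; rewrite in_cons js orbT.
by apply/funext => k; rewrite big_cons.
Qed.

Lemma is_derive_ln_affine (a b : R) : 0 < a ->
  is_derive (0 : R) 1 (fun h => ln (h * b + a)) (b / a).
Proof.
move=> a0.
have aff : is_derive (0 : R) 1 (fun h => h * b + a) b.
  rewrite (_ : (fun _ => _) = b \*: id + cst a).
    apply: is_derive_eq.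
    by rewrite addr0 [_%:A]mulr1.
  by apply/funext => h /=; rewrite [RHS]/(b * h + a) mulrC.
have lnd : is_derive (0 * b + a) 1 (@ln R) (0 * b + a)^-1.
  by apply: is_derive1_ln; rewrite mul0r add0r.
have := @is_derive1_comp R (@ln R) (fun h => h * b + a) 0 _ _ lnd aff.
by rewrite mul0r add0r mulrC.
Qed.

Lemma positive_vec_near x z : positive_vec x -> \forall h \near (0 : R), positive_vec (h *: z + x).
Proof.
move=> x0; have [m m0 mx] := positive_lower_bound x0.
have n0 := norm2_ge0 z.
apply/nbhs_ballP; exists (m / (norm2 z + 1)) => /=; first by rewrite divr_gt0//; lra.
move=> h; rewrite /ball/= sub0r normrN ltr_pdivlMr; last by lra.
move=> hm i; rewrite !mxE.
have : `|h * z i 0| <= `|h| * norm2 z by rewrite normrM ler_wpM2l// coord_le_norm2.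
have := mx i; rewrite ler_norml => ? /andP[? _].
have := normr_ge0 h; rewrite mulrDr mulr1 in hm; lra.
Qed.

Lemma derive_potential rs x z : positive_vec x -> all_simplex rs ->
  'D_z (fine \o potential eta rs) x = - slope eta rs x z.
Proof.
move=> x0 hrs; rewrite derive_line.
pose f (h : R) := - (eta^-1 * \sum_(i < d) ln (h * z i 0 + x i 0)
  + \sum_(r <- rs) ln (h * dot z r + dot x r)).
(* Near h = 0 all coordinates stay positive, so [fine] of the extended potential is the explicit
   function [f]. *)
have -> : 'D_1 (fun h : R => (fine \o potential eta rs) (h *: z + x)) 0 = 'D_1 f 0.
  apply: near_eq_derive; have := positive_vec_near z x0; apply: filterS => h hx.
  rewrite /= potentialE//= /f /real_potential; congr (- (_ * _ + _)).
    by apply: eq_bigr => i _; rewrite !mxE.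
  by apply: eq_bigr => r _; rewrite dotDl dotZl.
have d1 : is_derive (0 : R) 1 (fun h => \sum_(i < d) ln (h * z i 0 + x i 0))
    (\sum_(i < d) z i 0 / x i 0).
  by apply: is_derive_big_sum => i _; exact: is_derive_ln_affine.
have d2 : is_derive (0 : R) 1 (fun h => \sum_(r <- rs) ln (h * dot z r + dot x r))
    (\sum_(r <- rs) dot z r / dot x r).
  apply: is_derive_big_sum => r rrs; apply: is_derive_ln_affine.
  by apply: dot_pos_gt0 => //; exact: hrs.
have := is_deriveN (is_deriveD (is_deriveZ eta^-1 d1) d2) => dv.
exact: (@derive_val _ _ _ _ _ _ _ dv).
Qed.

Lemma slope_sum_delta rs x z :
  slope eta rs x z = \sum_(i < d) z i 0 * slope eta rs x (delta_mx i 0).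
Proof.
have dotE u r : dot u r = \sum_(i < d) u i 0 * dot (delta_mx i 0) r.
  rewrite {1}/dot; apply: eq_bigr => i _; congr (_ * _).
  rewrite /dot (bigD1 i)//= big1 => [|j ji]; rewrite mxE.
    by rewrite !eqxx mul1r addr0.
  by rewrite (negbTE ji) mul0r.
rewrite /slope /barrier_sum.
under [RHS]eq_bigr do rewrite mulrDr.
rewrite big_split/=; congr (_ + _).
  rewrite mulr_sumr; apply: eq_bigr => i _; rewrite mulrCA; congr (_ * _).
  rewrite (bigD1 i)//= big1 => [|j ji]; rewrite mxE.
    by rewrite !eqxx mul1r addr0 mulrC mulrC.
  by rewrite (negbTE ji) mul0r.
under [RHS]eq_bigr do rewrite mulr_sumr.
rewrite exchange_big/=; apply: eq_bigr => r _.
by rewrite dotE mulr_suml; apply: eq_bigr => i _; rewrite mulrA.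
Qed.

Lemma dot_gradient rs x z : positive_vec x -> all_simplex rs ->
  dot (gradient (fine \o potential eta rs) x) z = - slope eta rs x z.
Proof.
move=> x0 hrs; rewrite slope_sum_delta /dot -sumrN; apply: eq_bigr => i _.
by rewrite mxE derive_potential// mulNr mulrC.
Qed.

End Gradient.

(** * Effect of one move on the projected gradient *)

Section Move.
Context {R : realType} {d : nat}.
Variables (eta : R) (V : 'M[R]_(d, d.-1)).
Hypotheses (eta_gt0 : 0 < eta) (d_ge2 : (2 <= d)%N).
Hypothesis V_basis : orthonormal_basis_centroid_compl V.
Implicit Types (x y z r : 'cV[R]_d) (h : 'cV[R]_d.-1) (rs : seq 'cV[R]_d).

Let d_gt0 : (0 < d)%N. Proof. exact: ltn_trans d_ge2. Qed.

Lemma dot_basis h h' : dot (V *m h) (V *m h') = dot h h'.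
Proof. by case: V_basis => VV _; rewrite dot_mulmxl mulmxA VV mul1mx. Qed.

Lemma norm2_basis h : norm2 (V *m h) = norm2 h.
Proof. by rewrite /norm2 dot_basis. Qed.

Lemma basis_centroid : V^T *m centroid R d = 0.
Proof. by case: V_basis => _ Vk; apply/sub_kermxP; rewrite -Vk. Qed.

Lemma dot_basis_centroid h : dot (V *m h) (centroid R d) = 0.
Proof.
by rewrite dot_mulmxl basis_centroid /dot big1// => i _; rewrite mxE mulr0.
Qed.

Lemma sum_basis h : \sum_(i < d) (V *m h) i 0 = 0.
Proof.
have := dot_basis_centroid h; rewrite dot_centroidr => /eqP.
by rewrite mulf_eq0 invr_eq0 pnatr_eq0 -[d == _]negbK -lt0n d_gt0 orbF => /eqP.
Qed.

Lemma basis_span z : \sum_(i < d) z i 0 = 0 -> exists h, z = V *m h.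
Proof.
move=> z0; case: V_basis => _ Vk.
have : (z^T <= V^T)%MS.
  rewrite Vk; apply/sub_kermxP/matrixP => i j; rewrite !ord1 [RHS]mxE.
  have : dot z (centroid R d) = 0 by rewrite dot_centroidr z0 mul0r.
  by rewrite dotE.
by move=> /submxP[D zD]; exists D^T; rewrite -[LHS]trmxK zD trmx_mul trmxK.
Qed.

Definition proj_gradient rs x : 'cV[R]_d.-1 :=
  compl_proj V (gradient (fine \o potential eta rs) x).

Lemma dot_proj_gradient rs x h : positive_vec x -> all_simplex rs ->
  dot (proj_gradient rs x) h = - slope eta rs x (V *m h).
Proof.
by move=> x0 hrs; rewrite -dot_gradient// dotC -dot_mulmxl dotC.
Qed.

(** Test against g itself: |g|^2 is minus the slope along V g, hence at most B |V g| = B |g|,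
    because V is an isometry. *)
Lemma norm2_proj_gradient_le rs x B : positive_vec x -> all_simplex rs -> 0 <= B ->
  (forall z, \sum_(i < d) z i 0 = 0 -> `|slope eta rs x z| <= B * norm2 z) ->
  norm2 (proj_gradient rs x) <= B.
Proof.
move=> x0 hrs B0 hB; set g := proj_gradient rs x.
have [->|g0] := eqVneq (norm2 g) 0; first exact: B0.
have gp : 0 < norm2 g by rewrite lt_neqAle eq_sym g0 norm2_ge0.
rewrite -(ler_pM2r gp) -expr2 norm2_sqr dot_proj_gradient//.
apply: le_trans (ler_norm _) _; rewrite normrN -(norm2_basis g).
by apply: hB; exact: sum_basis.
Qed.

(** A while loop ends as soon as the projected gradient at the target vanishes: the target is then
    stationary in every direction of coordinate sum 0. *)
Lemma lb_ftrl_proj_gradient0 rs x : all_simplex rs -> simplex x -> positive_vec x ->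
  proj_gradient rs x = 0 -> lb_ftrl eta rs = x.
Proof.
move=> hrs xs x0 g0; apply: lb_ftrl_unique => // z /basis_span[h ->].
apply/eqP; rewrite -oppr_eq0 -dot_proj_gradient// g0.
by rewrite /dot big1// => i _; rewrite mxE mul0r.
Qed.

Section Step.
Variables (T : nat) (rs : seq 'cV[R]_d) (x : 'cV[R]_d).
Let tau : R := T%:R `^ (- 2^-1).
Hypotheses (tau_gt0 : 0 < tau) (tau_le : tau <= (2 * d%:R)^-1).
Hypotheses (hrs : all_simplex rs) (xs : simplex x) (x0 : positive_vec x).
Let g := proj_gradient rs x.
Hypothesis g_neq0 : g != 0.
Let r := move T V x (potential eta rs).

(** The minimum over [\bar R] in real terms: either the second bound is attained, d m lam = 1, or
    the first one is; for m = 0 the second bound is [+oo]. *)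
Lemma move_scale : exists2 lam, r = V *m (lam *: g) + centroid R d &
  let m := Num.max (1 - dot g (V^T *m x)) 0 in
  [/\ 0 < lam, lam <= tau / norm2 g &
   d%:R * m * lam = 1 \/ lam = tau / norm2 g /\ d%:R * m * lam <= 1].
Proof.
have gp := norm2_gt0 g_neq0.
set m := Num.max (1 - dot g (V^T *m x)) 0.
have m0 : 0 <= m by rewrite le_max lexx orbT.
have dp : 0 < d%:R :> R by rewrite ltr0n.
rewrite /r /move -/g; set l := fine _; exists l => //=; rewrite -/m.
have lE : l = fine (Order.min (tau / norm2 g)%:E (1 / (d%:R * m)%:E)%E).
  rewrite /l /compl_proj -/m; congr (fine (Order.min _ _)).
  by rewrite inver gt_eqF.
have tg : 0 < tau / norm2 g by rewrite divr_gt0.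
have [me|mn] := eqVneq m 0.
  have {}lE : l = tau / norm2 g.
    by rewrite lE me mulr0 inver eqxx mul1e min_l// leey.
  by rewrite lE; split => //; right; split => //; rewrite me mulr0 mul0r.
have mp : 0 < m by rewrite lt_neqAle eq_sym mn.
have dmp : 0 < d%:R * m by rewrite mulr_gt0.
have {}lE : l = Num.min (tau / norm2 g) (d%:R * m)^-1.
  by rewrite lE inver gt_eqF// mul1e -EFin_min.
rewrite lE; split; first by rewrite lt_min tg invr_gt0.
  by rewrite ge_min lexx.
have [le|lt] := leP (tau / norm2 g) (d%:R * m)^-1.
  by right; split => //; rewrite mulrC -ler_pdivlMr// mul1r.
by left; rewrite divff// gt_eqF.
Qed.

Lemma move_close : norm2 (r - centroid R d) <= tau.
Proof.
have [lam rE [lam0 lam1 _]] := move_scale; have gp := norm2_gt0 g_neq0.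
rewrite rE addrK norm2_basis.
by rewrite norm2Z ?(ltW lam0)// -ler_pdivlMr.
Qed.

Lemma move_sum : \sum_(i < d) r i 0 = 1.
Proof.
have [lam -> _] := move_scale.
under eq_bigr do rewrite mxE.
by rewrite big_split/= sum_basis add0r; case: (@centroid_simplex R d d_gt0).
Qed.

End Step.

Lemma close_simplex tau r : tau <= (2 * d%:R)^-1 -> norm2 (r - centroid R d) <= tau ->
  \sum_(i < d) r i 0 = 1 -> simplex r.
Proof.
move=> ht hr r1; split => // i.
have := le_trans (coord_le_norm2 (r - centroid R d) i) hr.
have : 0 < d%:R :> R by rewrite ltr0n.
rewrite !mxE ler_norml invfM in ht * => dp /andP[h _].
have : 0 < d%:R^-1 :> R by rewrite invr_gt0.
lra.
Qed.

Lemma close_dot tau x r : tau <= (2 * d%:R)^-1 -> norm2 (r - centroid R d) <= tau ->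
  simplex x -> (2 * d%:R)^-1 <= dot x r <= 1.
Proof.
move=> ht hr xs; have := dot_close_le hr xs.
have : d%:R^-1 <= 2^-1 :> R by rewrite lef_pV2 ?posrE ?ltr0n// ler_nat.
rewrite invfM in ht * => h1; rewrite ler_norml => /andP[h4 h5].
by apply/andP; split; lra.
Qed.

(** With D = <x, r>, the new loss turns the projected gradient g into (1 - lam / D) g, and D = lam
    <g, V^T x> + 1/d. If the second bound on the step is attained, then lam = D and the gradient
    vanishes. Otherwise lam <= D and the norm drops by tau / D, which is at least tau because D <=
    1. *)
Lemma move_step (T : nat) rs x : let tau := T%:R `^ (- 2^-1) in
  0 < tau -> tau <= (2 * d%:R)^-1 -> all_simplex rs -> simplex x -> positive_vec x ->
  proj_gradient rs x != 0 ->
  let r := move T V x (potential eta rs) in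
  [/\ simplex r, norm2 (r - centroid R d) <= tau &
   proj_gradient (rcons rs r) x = 0 \/
   norm2 (proj_gradient (rcons rs r) x) <= norm2 (proj_gradient rs x) - tau].
Proof.
move=> tau tau0 taule hrs xs x0 g0 r.
have rc := move_close tau0 g0; have r1 := move_sum tau0 g0.
have rs' : simplex r by exact: close_simplex taule rc r1.
split => //.
have [lam rE [lam0 _ lamP]] := move_scale tau0 g0; rewrite -/r in rc r1 rE.
set g := proj_gradient rs x in g0 rE lamP *.
have /andP[D1 D2] := close_dot taule rc xs; set D := dot x r in D1 D2.
have dp : 0 < d%:R :> R by rewrite ltr0n.
have Dp : 0 < D by apply: lt_le_trans D1; rewrite invr_gt0 mulr_gt0.
have hrs' := all_simplex_rcons rs' hrs.
have DE : D = lam * dot g (V^T *m x) + d%:R^-1.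
  rewrite /D rE dotDr dot_simplex_centroid//; congr (_ + _).
  by rewrite dotC dot_mulmxl dotZl.
have g'E : proj_gradient (rcons rs r) x = (1 - lam / D) *: g.
  (* The projected gradient is known through its inner products, so the difference [u] of both sides
     is tested against itself. *)
  apply/eqP; rewrite -subr_eq0; apply/eqP/norm2_eq0.
  rewrite /norm2; set u := _ - _; suff -> : dot u u = 0 by rewrite sqrtr0.
  rewrite {1}/u dotBl dotZl !dot_proj_gradient// /slope barrier_sum_rcons.
  rewrite -!/(slope _ _ _ _) -/D.
  have -> : dot (V *m u) r = lam * dot g u.
    by rewrite rE dotDr dot_basis_centroid addr0 dot_basis dotZr dotC.
  by rewrite dot_proj_gradient//; field; exact: lt0r_neq0.
have [e1|[lamE e1]] := lamP.
  left; rewrite g'E.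
  have : Num.max (1 - dot g (V^T *m x)) 0 = 1 - dot g (V^T *m x).
    apply: max_l; rewrite leNgt; apply/negP => /ltW m0; move: e1.
    by rewrite max_r// mulr0 mul0r => /esym/eqP; rewrite oner_eq0.
  move=> mE; rewrite mE in e1.
  have -> : D = lam.
    rewrite DE; have -> : d%:R^-1 = (1 - dot g (V^T *m x)) * lam.
      apply: (mulfI (lt0r_neq0 dp)); rewrite mulfV ?lt0r_neq0// -[LHS]e1; ring.
    ring.
  by rewrite divff ?lt0r_neq0// subrr scale0r.
right; rewrite g'E.
have lamD : lam <= D.
  rewrite DE -lerBlDl -(ler_pM2l dp) mulfV ?lt0r_neq0//; apply: le_trans e1.
  have -> : lam - lam * dot g (V^T *m x) = (1 - dot g (V^T *m x)) * lam by ring.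
  by rewrite mulrA ler_wpM2r ?(ltW lam0)// ler_wpM2l ?(ltW dp)// le_max lexx.
have k0 : 0 <= 1 - lam / D by rewrite subr_ge0 ler_pdivrMr// mul1r.
have gp := norm2_gt0 g0.
rewrite norm2Z// mulrBl mul1r lerD2l lerN2 lamE.
have -> : tau / norm2 g / D * norm2 g = tau / D.
  by field; rewrite !lt0r_neq0.
by rewrite ler_pdivlMr// ler_piMr// ltW.
Qed.

End Move.

(** * Gain of an oracle round *)

Section MixedPoints.
Context {R : realType} {d : nat}.
Hypothesis d_gt0 : (0 < d)%N.
Implicit Types (x y z r t : 'cV[R]_d) (e : R).

(** With e = 1 - c_s this is x^(s). *)
Definition centroid_mix e x : 'cV[R]_d := (1 - e) *: x + e *: centroid R d.

Lemma centroid_mix_simplex e x : 0 <= e <= 1 -> simplex x -> simplex (centroid_mix e x).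
Proof.
move=> /andP[e0 e1] xs; rewrite /centroid_mix -{2}(subKr 1 e).
by apply: simplex_convex => //; [apply/andP; lra|exact: centroid_simplex].
Qed.

Lemma centroid_mix_coord_ge e x i : 0 <= e <= 1 -> simplex x ->
  e / d%:R <= centroid_mix e x i 0.
Proof.
by move=> /andP[e0 e1] [x0 _]; rewrite !mxE lerDr mulr_ge0// subr_ge0.
Qed.

Lemma dot_centroid_mixl e x r : simplex r ->
  dot (centroid_mix e x) r = (1 - e) * dot x r + e / d%:R.
Proof. by move=> rs; rewrite dotDl !dotZl dot_centroid_simplex. Qed.

Lemma dot_centroid_mixr e x r : simplex x ->
  dot x (centroid_mix e r) = (1 - e) * dot x r + e / d%:R.
Proof. by move=> xs; rewrite dotDr !dotZr dot_simplex_centroid. Qed.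

Section Perturbation.
Variables (e rho : R) (t : 'cV[R]_d).
Hypotheses (e0 : 0 < e) (e_le : e <= 2^-1) (rho0 : 0 <= rho) (ts : simplex t).
Let x := centroid_mix e t.
(** Adding it to [centroid_mix e t] gives [centroid_mix ((1 + rho) * e) t]: the weight of the
    centroid grows by the relative amount [rho]. *)
Definition toward_centroid : 'cV[R]_d := (rho * e) *: (centroid R d - t).
Let z := toward_centroid.

Let e01 : 0 <= e <= 1. Proof. by apply/andP; have := e0; have := e_le; lra. Qed.
Let dinv_gt0 : 0 < d%:R^-1 :> R. Proof. by rewrite invr_gt0 ltr0n. Qed.
Let cs := @centroid_simplex R d d_gt0.

Lemma toward_centroid_sum : \sum_(i < d) z i 0 = 0.
Proof.
under eq_bigr do rewrite mxE.
by rewrite -mulr_sumr sum_sub_simplex// mulr0.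
Qed.

Lemma dot_toward_centroid r : simplex r -> dot z r = rho * e * (d%:R^-1 - dot t r).
Proof. by move=> rs; rewrite dotZl dotBl dot_centroid_simplex. Qed.

Lemma toward_centroid_abs_le i : `|z i 0| <= rho * x i 0.
Proof.
rewrite !mxE -mulrA normrM (ger0_norm rho0) ler_wpM2l//.
have := e0; have := e_le; have [/(_ i) ti0 _] := ts; have D := dinv_gt0 => h1 h2.
rewrite ler_norml; apply/andP; split; nra.
Qed.

(** As <t, o> = 0, increment and base value are both of order e / d; their quotient is rho (1 - e) /
    (2 - e). *)
Lemma same_oracle_ge o : simplex o -> dot t o = 0 ->
  rho / 4 <= dot z (centroid_mix e o) / dot x (centroid_mix e o).
Proof.
move=> os to0.
have rs := centroid_mix_simplex e01 os.
rewrite dot_toward_centroid// dot_centroid_mixl// dot_centroid_mixr// to0.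
have D := dinv_gt0; have h0 := e0; have h1 := e_le; rewrite mulr0 add0r.
have -> : (1 - e) * (e / d%:R) + e / d%:R = e / d%:R * (2 - e) by ring.
rewrite ler_pdivlMr; last by rewrite mulr_gt0 ?mulr_gt0//; lra.
have -> : rho * e * (d%:R^-1 - e / d%:R) = rho / 4 * (e / d%:R * (4 * (1 - e))).
  by field; rewrite pnatr_eq0 -lt0n.
have rho4 : 0 <= rho / 4 by rewrite divr_ge0.
have ed : 0 <= e / d%:R by rewrite mulr_ge0 ?ltW.
by rewrite ler_wpM2l// ler_wpM2l//; lra.
Qed.

(** The base value is at least (e + e') / (2 d), the increment at most rho e / d. The factor e / (e
    + e') damps the levels with e' much larger than e. *)
Lemma same_oracle_le e' o : simplex o -> dot t o = 0 -> 0 < e' <= 2^-1 ->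
  0 <= dot z (centroid_mix e' o) / dot x (centroid_mix e' o) <= 2 * rho * (e / (e + e')).
Proof.
move=> os to0 /andP[e'0 e'le]; have e'01 : 0 <= e' <= 1 by apply/andP; lra.
have rs := centroid_mix_simplex e'01 os.
rewrite dot_toward_centroid// dot_centroid_mixl// dot_centroid_mixr// to0 mulr0 add0r.
have D := dinv_gt0; have h0 := e0; have h1 := e_le.
have -> : rho * e * (d%:R^-1 - e' / d%:R) = rho * e * (1 - e') / d%:R by ring.
have -> : (1 - e) * (e' / d%:R) + e / d%:R = ((1 - e) * e' + e) / d%:R by ring.
have den : 0 < (1 - e) * e' + e by nra.
have -> : rho * e * (1 - e') / d%:R / (((1 - e) * e' + e) / d%:R) =
   rho * e * (1 - e') / ((1 - e) * e' + e).
  by field; rewrite gt_eqF//= pnatr_eq0 -lt0n.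
have re : 0 <= rho * e by rewrite mulr_ge0// ltW.
apply/andP; split.
  by rewrite divr_ge0 ?mulr_ge0//; lra.
have ee : 0 < e + e' by lra.
have -> : 2 * rho * (e / (e + e')) = rho * e * 2 / (e + e') by field; lra.
rewrite ler_pdivrMr// -[leRHS]mulrAC ler_pdivlMr// -!mulrA mulrA [leRHS]mulrA.
by rewrite ler_wpM2l//; nra.
Qed.

(** Here the base value stays above L / 4 however small e is, whereas the increment is at most rho e
    in absolute value. *)
Lemma other_oracle_le L e' o : simplex o -> 0 < L -> L <= dot t o -> 0 < e' <= 2^-1 ->
  (dot z (centroid_mix e' o) / dot x (centroid_mix e' o)) ^+ 2 <= 16 * rho ^+ 2 * (e / L) ^+ 2.
Proof.
move=> os L0 toL /andP[e'0 e'le]; have e'01 : 0 <= e' <= 1 by apply/andP; lra.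
have D := dinv_gt0; have h0 := e0; have h1 := e_le.
set r := centroid_mix e' o; have rs : simplex r by exact: centroid_mix_simplex.
have xr : L / 4 <= dot x r.
  rewrite dot_centroid_mixl// dot_centroid_mixr//.
  have : L / 2 <= (1 - e') * dot t o + e' / d%:R.
    have : 0 < e' / d%:R by rewrite mulr_gt0.
    nra.
  have : 0 < e / d%:R by rewrite mulr_gt0.
  nra.
have -> : 16 * rho ^+ 2 * (e / L) ^+ 2 = (4 * rho * (e / L)) ^+ 2 by ring.
have re : 0 <= rho * e by rewrite mulr_ge0// ltW.
rewrite -ler_sqrt ?sqr_ge0// !sqrtr_sqr normrM normfV (gtr0_norm (lt_le_trans _ xr)); last by lra.
have eL : 0 < e / L by rewrite divr_gt0.
have B0 : 0 <= 4 * rho * (e / L) by apply: mulr_ge0 (ltW eL); exact: mulr_ge0.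
rewrite (ger0_norm B0).
rewrite ler_pdivrMr; last by lra.
have zr : `|dot z r| <= rho * e.
  rewrite dot_toward_centroid// normrM (ger0_norm re) ler_piMr//.
  have := dot_simplex_ge0 ts rs; have := dot_simplex_le1 ts rs.
  have : d%:R^-1 <= 1 :> R by rewrite invf_le1 ?ltr0n// ler1n.
  by move=> ? ? ?; rewrite ler_norml; apply/andP; split; lra.
apply: le_trans zr _.
have -> : rho * e = 4 * rho * (e / L) * (L / 4) by field; lra.
by rewrite ler_wpM2l.
Qed.

(** <t, q> differs from 1/d by at most tau, so the increment is at most rho e tau in absolute value,
    while <x, q> is at least 1 / (2 d). *)
Lemma close_return_le tau q : tau <= (2 * d%:R)^-1 -> norm2 (q - centroid R d) <= tau ->
  simplex q -> (dot z q / dot x q) ^+ 2 <= 16 * rho ^+ 2 * (d%:R * e) ^+ 2 * tau ^+ 2.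
Proof.
move=> taule qc qs.
have xs : simplex x by exact: centroid_mix_simplex.
have D := dinv_gt0; have h0 := e0.
have dist y := @dot_close_le R d tau y q qc.
have tau0 : 0 <= tau by exact: le_trans (norm2_ge0 _) qc.
have re : 0 <= rho * e by rewrite mulr_ge0// ltW.
have dp : 0 < d%:R :> R by rewrite ltr0n.
have xq : (2 * d%:R)^-1 <= dot x q.
  have := dist _ xs; rewrite ler_norml => /andP[+ _]; rewrite invfM in taule *; lra.
have -> : 16 * rho ^+ 2 * (d%:R * e) ^+ 2 * tau ^+ 2 = (4 * rho * (d%:R * e) * tau) ^+ 2 by ring.
have xq0 : 0 < dot x q by apply: lt_le_trans xq; rewrite invr_gt0 mulr_gt0.
rewrite -ler_sqrt ?sqr_ge0// !sqrtr_sqr normrM normfV (gtr0_norm xq0).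
have B0 : 0 <= 4 * rho * (d%:R * e) * tau.
  by rewrite mulr_ge0// mulr_ge0// mulr_ge0// ltW.
rewrite (ger0_norm B0) ler_pdivrMr// dot_toward_centroid// normrM (ger0_norm re).
have := dist _ ts; rewrite distrC => tq.
apply: (@le_trans _ _ (rho * e * tau)); first by rewrite ler_wpM2l.
apply: (@le_trans _ _ (4 * rho * (d%:R * e) * tau * (2 * d%:R)^-1)).
  have -> : 4 * rho * (d%:R * e) * tau * (2 * d%:R)^-1 = 2 * (rho * e * tau).
    by field; lra.
  by rewrite ler_peMl ?mulr_ge0//; lra.
by rewrite ler_wpM2l.
Qed.

End Perturbation.
End MixedPoints.

Section Stability.
Context {R : realType} {d N : nat}.
Variables (eta L tau : R) (eps : nat -> R) (tgt orc : 'I_N -> 'cV[R]_d).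
Hypotheses (eta_gt0 : 0 < eta) (d_gt0 : (0 < d)%N) (L_gt0 : 0 < L).
Hypotheses (tgt_simplex : forall i, simplex (tgt i)).
Hypotheses (orc_simplex : forall i, simplex (orc i)).
Hypothesis tgt_orc_lt : forall i j : 'I_N, (j < i)%N -> L <= dot (tgt i) (orc j).
Hypothesis tgt_orc_eq0 : forall i, dot (tgt i) (orc i) = 0.
Implicit Types (x y z r q : 'cV[R]_d) (rs qs : seq 'cV[R]_d) (p : 'I_N * nat)
  (s : nat) (done : seq ('I_N * nat)).

Definition target_point p := centroid_mix (eps p.2) (tgt p.1).
Definition oracle_return p := centroid_mix (eps p.2) (orc p.1).

Lemma barrier_sum_perm phi rs done qs x z : perm_eq rs (map oracle_return done ++ qs) ->
  barrier_sum eta phi rs x z =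
  eta^-1 * (\sum_(i < d) phi (z i 0) (x i 0))
  + (\sum_(p <- done) phi (dot z (oracle_return p)) (dot x (oracle_return p))
     + \sum_(q <- qs) phi (dot z q) (dot x q)).
Proof. by move=> hp; rewrite /barrier_sum (perm_big _ hp) big_cat/= big_map. Qed.

(** Meant for the returns outside oracle rounds: the moves, and the centroid once the loops are
    over. *)
Definition close_returns qs := forall q, q \in qs ->
  simplex q /\ norm2 (q - centroid R d) <= tau.

Section OracleRound.
Variables (i : 'I_N) (s : nat) (rho : R) (rs qs : seq 'cV[R]_d) (done : seq ('I_N * nat)).
Let e := eps s.
Let x := target_point (i, s).
Let z := toward_centroid e rho (tgt i).
Hypotheses (e_gt0 : 0 < e) (e_le : e <= 2^-1) (rho_ge0 : 0 <= rho).
Hypothesis rs_perm : perm_eq rs (map oracle_return done ++ qs).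
Hypothesis done_le : forall p, p \in done -> (p.1 <= i)%N /\ 0 < eps p.2 <= 2^-1.
Hypothesis taule : tau <= (2 * d%:R)^-1.
Hypothesis qs_close : close_returns qs.
Hypothesis qs_size : (size qs)%:R * tau ^+ 2 <= 1.
Hypothesis done_size : (size done)%:R * (16 * (e / L) ^+ 2) <= 1.
Hypothesis e_small : 16 * (d%:R * e) ^+ 2 <= 1.

Let ts := tgt_simplex i.
Let e01 : 0 <= e <= 1. Proof. by apply/andP; have := e_gt0; have := e_le; lra. Qed.
Let B := \sum_(p <- done | p.1 == i) (e / (e + eps p.2)) ^+ 2.

(** In units of rho^2, the regularizer gives d / eta, the returns of the same target 4 [B], those of
    earlier targets at most 1 by [done_size], and the close returns at most 1 by [qs_size] and
    [e_small]. *)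
Lemma sq_sum_oracle_le : sq_sum eta rs x z <= rho ^+ 2 * (d%:R / eta + 4 * B + 2).
Proof.
have xs : simplex x by exact: centroid_mix_simplex.
have x0 j : 0 < x j 0.
  apply: lt_le_trans (centroid_mix_coord_ge j e01 ts).
  by rewrite divr_gt0 ?ltr0n.
rewrite /sq_sum (barrier_sum_perm _ _ _ rs_perm).
have reg : \sum_(j < d) (z j 0 / x j 0) ^+ 2 <= d%:R * rho ^+ 2.
  have -> : d%:R * rho ^+ 2 = \sum_(j < d) rho ^+ 2.
    by rewrite sumr_const card_ord mulr_natl.
  apply: ler_sum => j _; rewrite -[leLHS]real_normK ?num_real// ler_sqr ?nnegrE//.
  rewrite normrM normfV (gtr0_norm (x0 j)) ler_pdivrMr//.
  exact: toward_centroid_abs_le.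
have small : \sum_(q <- qs) (dot z q / dot x q) ^+ 2 <= rho ^+ 2.
  apply: (@le_trans _ _ (\sum_(q <- qs) 16 * rho ^+ 2 * (d%:R * e) ^+ 2 * tau ^+ 2)).
    rewrite big_seq [leRHS]big_seq; apply: ler_sum => q /qs_close[qS qc].
    exact: close_return_le.
  rewrite big_const_seq count_predT iter_addr_0 -[leLHS]mulr_natr.
  have -> : 16 * rho ^+ 2 * (d%:R * e) ^+ 2 * tau ^+ 2 * (size qs)%:R =
    rho ^+ 2 * ((16 * (d%:R * e) ^+ 2) * ((size qs)%:R * tau ^+ 2)) by ring.
  rewrite ler_piMr ?sqr_ge0//; apply: mulr_ile1 => //.
    by rewrite mulr_ge0// sqr_ge0.
  by rewrite mulr_ge0// sqr_ge0.
have orcl : \sum_(p <- done) (dot z (oracle_return p) / dot x (oracle_return p)) ^+ 2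
    <= rho ^+ 2 * (4 * B + 1).
  rewrite (bigID (fun p => p.1 == i))/= mulrDr mulr1; apply: lerD.
    rewrite /B !mulr_sumr big_seq_cond [leRHS]big_seq_cond; apply: ler_sum => p /andP[pd /eqP pi].
    have [_ ep] := done_le pd.
    have -> : rho ^+ 2 * (4 * (e / (e + eps p.2)) ^+ 2) =
      (2 * rho * (e / (e + eps p.2))) ^+ 2 by ring.
    have /andP[w0 w1] : 0 <= dot z (oracle_return p) / dot x (oracle_return p) <=
        2 * rho * (e / (e + eps p.2)).
      by rewrite /oracle_return pi; apply: same_oracle_le.
    by rewrite ler_sqr// nnegrE// (le_trans w0).
  apply: (@le_trans _ _ (\sum_(p <- done) 16 * rho ^+ 2 * (e / L) ^+ 2)).
    rewrite [leRHS](bigID (fun p => p.1 == i))/=.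
    rewrite -[leLHS]add0r; apply: lerD.
      by apply: sumr_ge0 => p _; rewrite mulr_ge0 ?sqr_ge0// mulr_ge0 ?sqr_ge0.
    rewrite big_seq_cond [leRHS]big_seq_cond; apply: ler_sum => p /andP[pd pi].
    have [ple ep] := done_le pd; apply: other_oracle_le => //.
    by apply: tgt_orc_lt; rewrite ltn_neqAle ple andbT; exact: contra pi.
  rewrite big_const_seq count_predT iter_addr_0 -[leLHS]mulr_natr.
  have -> : 16 * rho ^+ 2 * (e / L) ^+ 2 * (size done)%:R =
    rho ^+ 2 * ((size done)%:R * (16 * (e / L) ^+ 2)) by ring.
  by rewrite ler_piMr// sqr_ge0.
have regeta : eta^-1 * \sum_(j < d) (z j 0 / x j 0) ^+ 2 <= eta^-1 * (d%:R * rho ^+ 2).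
  by rewrite ler_pM2l// invr_gt0.
apply: le_trans (lerD regeta (lerD orcl small)) _.
by rewrite le_eqVlt; apply/orP; left; apply/eqP; ring.
Qed.

(** The candidate x + z bounds the new minimum. Its slope term is 0 because x minimizes the old
    potential, the new logarithm gains at least rho / 8, and twice [sq_sum] costs at most 2 rho^2
    (10 K) = rho / 16. What remains is rho / 16. *)
Lemma oracle_round_gain K : all_simplex rs -> lb_ftrl eta rs = x ->
  1 <= K -> d%:R / eta + 4 * B + 2 <= 10 * K -> rho = (320 * K)^-1 ->
  real_potential eta (rcons rs (oracle_return (i, s)))
    (lb_ftrl eta (rcons rs (oracle_return (i, s)))) <=
  real_potential eta rs x - ln (dot x (oracle_return (i, s))) - (16 * (320 * K))^-1.
Proof.
move=> hrs xE K1 hK rhoE; set r := oracle_return (i, s); set rs' := rcons rs r.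
have rS : simplex r by exact: centroid_mix_simplex.
have xs : simplex x by exact: centroid_mix_simplex.
have x0 : positive_vec x.
  move=> j; apply: lt_le_trans (centroid_mix_coord_ge j e01 ts).
  by rewrite divr_gt0 ?ltr0n.
have hrs' : all_simplex rs' by exact: all_simplex_rcons.
have z0 : \sum_(j < d) z j 0 = 0 by exact: toward_centroid_sum.
have st : slope eta rs x z = 0 by rewrite -xE slope_lb_ftrl.
clear xE.
have rK : rho * K = 320^-1 by rewrite rhoE; field; lra.
have rho1 : rho <= 320^-1 by rewrite -rK; exact: ler_peMr rho_ge0 K1.
have zx j : `|z j 0| <= 2^-1 * x j 0.
  apply: le_trans (toward_centroid_abs_le d_gt0 e_gt0 e_le rho_ge0 ts j) _.
  by rewrite ler_wpM2r//; [exact: ltW|lra].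
have [xz0 ub] := real_potential_ub eta_gt0 x0 hrs zx.
have xzs : simplex (x + z).
  split=> [j|]; first exact: ltW.
  under eq_bigr do rewrite mxE.
  by rewrite big_split/= z0 addr0; case: xs.
apply: le_trans (lb_ftrl_min eta_gt0 d_gt0 hrs' xzs xz0) _.
have -> : real_potential eta rs' (x + z) = real_potential eta rs (x + z) - ln (dot (x + z) r).
  by rewrite /real_potential /rs' big_rcons/= addrA opprD.
have sq := sq_sum_oracle_le.
have xr := dot_pos_gt0 x0 rS.
have w := @same_oracle_ge R d d_gt0 e rho (tgt i) e_gt0 e_le rho_ge0 ts _
  (orc_simplex i) (tgt_orc_eq0 i).
rewrite -/z -[centroid_mix _ _]/r -[centroid_mix _ _]/x in w.
have -> : ln (dot (x + z) r) = ln (dot x r) + ln (1 + dot z r / dot x r).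
  rewrite dotDl -lnM ?posrE//; last by have := rho_ge0; lra.
  by congr ln; field; exact: lt0r_neq0.
have lnw : rho / 8 <= ln (1 + dot z r / dot x r).
  apply: (@le_trans _ _ (ln (1 + rho / 4))).
    apply: le_trans (ln1D_ge _); last by have := rho_ge0; lra.
    by have := rho_ge0; nra.
  by rewrite ler_ln ?posrE; have := rho_ge0; lra.
have sqK : sq_sum eta rs x z <= rho / 32.
  apply: le_trans sq _; apply: (@le_trans _ _ (rho ^+ 2 * (10 * K))).
    by rewrite ler_wpM2l// sqr_ge0.
  rewrite expr2 -mulrA [X in rho * X]mulrCA rK; lra.
have -> : (16 * (320 * K))^-1 = rho / 16 by rewrite rhoE; field; lra.
move: ub; rewrite st; lra.
Qed.

End OracleRound.
End Stability.

(** * Slope at the next target and regret *)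

Section SlopeBound.
Context {R : realType} {d : nat}.
Variables (eta tau m : R).
Hypotheses (eta_gt0 : 0 < eta) (d_ge2 : (2 <= d)%N) (m_gt0 : 0 < m).
Hypothesis taule : tau <= (2 * d%:R)^-1.
Implicit Types (x y z r q : 'cV[R]_d) (os qs rs : seq 'cV[R]_d).

Let d_gt0 : (0 < d)%N. Proof. exact: ltn_trans d_ge2. Qed.

Lemma dot_div_le x z r : (forall i, m <= x i 0) -> simplex r ->
  `|dot z r / dot x r| <= norm2 z / m.
Proof.
move=> xm rs; have xr := dot_simplex_ge xm rs.
rewrite normrM normfV (gtr0_norm (lt_le_trans m_gt0 xr)).
apply: ler_pM; rewrite ?invr_ge0 ?(le_trans (ltW m_gt0) xr)//.
  apply: le_trans (cauchy_schwarz _ _) _; rewrite ler_piMr ?norm2_ge0//.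
  exact: simplex_norm2_le1.
by rewrite lef_pV2 ?posrE// (lt_le_trans m_gt0 xr).
Qed.

Lemma slope_coord_ge_bound os x z : (forall i, m <= x i 0) -> all_simplex os ->
  `|slope eta os x z| <= (d%:R / eta + (size os)%:R) / m * norm2 z.
Proof.
move=> xm hos; apply: le_trans (ler_normD _ _) _.
rewrite mulrDl mulrDl; apply: lerD.
  rewrite normrM gtr0_norm ?invr_gt0//.
  have -> : d%:R / eta / m * norm2 z = eta^-1 * (\sum_(i < d) norm2 z / m).
    by rewrite sumr_const card_ord -mulr_natl; ring.
  rewrite ler_pM2l ?invr_gt0//; apply: le_trans (ler_norm_sum _ _ _) _.
  apply: ler_sum => i _; have xi := xm i.
  rewrite normrM normfV (gtr0_norm (lt_le_trans m_gt0 xi)).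
  apply: ler_pM; rewrite ?invr_ge0 ?(le_trans (ltW m_gt0) xi)// ?coord_le_norm2//.
  by rewrite lef_pV2 ?posrE// (lt_le_trans m_gt0 xi).
apply: le_trans (ler_norm_sum _ _ _) _.
have -> : (size os)%:R / m * norm2 z = \sum_(r <- os) norm2 z / m.
  by rewrite big_const_seq count_predT iter_addr_0 -[RHS]mulr_natl; ring.
rewrite big_seq [leRHS]big_seq; apply: ler_sum => r ro.
by apply: dot_div_le => //; exact: hos.
Qed.

(** One factor tau comes from <z, q> = <z, q - c>, valid for z of coordinate sum 0, the other from
    <y, q> - <x, q>, as both are within tau of 1/d. So even T close returns contribute only O(d^2)
    |z| when T tau^2 <= 1. *)
Lemma close_slope_diff q x y z : simplex q -> norm2 (q - centroid R d) <= tau ->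
  simplex x -> simplex y -> \sum_(i < d) z i 0 = 0 ->
  `|dot z q / dot x q - dot z q / dot y q| <= 8 * d%:R ^+ 2 * tau ^+ 2 * norm2 z.
Proof.
move=> qs qc xs ys z0.
have dp : 0 < d%:R :> R by rewrite ltr0n.
have i0 : 0 < (2 * d%:R)^-1 :> R by rewrite invr_gt0 mulr_gt0.
have tau0 : 0 <= tau by exact: le_trans (norm2_ge0 _) qc.
have zq : `|dot z q| <= norm2 z * tau.
  have -> : dot z q = dot z (q - centroid R d).
    by rewrite dotBr dot_centroidr z0 mul0r subr0.
  by apply: le_trans (cauchy_schwarz _ _) _; rewrite ler_wpM2l// norm2_ge0.
have dist u := @dot_close_le R d tau u q qc.
have inv u : simplex u -> 0 <= (dot u q)^-1 <= 2 * d%:R.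
  move=> us; have /andP[h _] := close_dot d_ge2 taule qc us.
  have h0 := lt_le_trans i0 h.
  by rewrite invr_ge0 ltW//= -[2 * d%:R]invrK lef_pV2 ?posrE.
have xy : `|dot y q - dot x q| <= 2 * tau.
  have := dist _ xs; have := dist _ ys; rewrite !ler_norml => /andP[? ?] /andP[? ?].
  by apply/andP; split; lra.
have /andP[x0 x1] := inv _ xs; have /andP[y0 y1] := inv _ ys.
have xn0 : dot x q != 0.
  by have /andP[h _] := close_dot d_ge2 taule qc xs; rewrite gt_eqF// (lt_le_trans i0).
have yn0 : dot y q != 0.
  by have /andP[h _] := close_dot d_ge2 taule qc ys; rewrite gt_eqF// (lt_le_trans i0).
have -> : dot z q / dot x q - dot z q / dot y q =
    dot z q * ((dot y q - dot x q) * ((dot x q)^-1 * (dot y q)^-1)).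
  by field; rewrite xn0 yn0.
rewrite !normrM (ger0_norm x0) (ger0_norm y0).
have -> : 8 * d%:R ^+ 2 * tau ^+ 2 * norm2 z =
  norm2 z * tau * (2 * tau * (2 * d%:R * (2 * d%:R))) by ring.
have h1 : (dot x q)^-1 * (dot y q)^-1 <= 2 * d%:R * (2 * d%:R) by exact: ler_pM.
have h2 : `|dot y q - dot x q| * ((dot x q)^-1 * (dot y q)^-1) <=
    2 * tau * (2 * d%:R * (2 * d%:R)) by apply: ler_pM => //; exact: mulr_ge0.
by apply: ler_pM => //; rewrite mulr_ge0// mulr_ge0.
Qed.

(* At [y] the close returns cancel the slope of the other terms, and between [x]
   and [y] their total slope hardly changes. *)
Lemma slope_transfer rs os qs x y z : perm_eq rs (os ++ qs) -> all_simplex rs ->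
  (forall q, q \in qs -> simplex q /\ norm2 (q - centroid R d) <= tau) ->
  (size qs)%:R * tau ^+ 2 <= 1 ->
  simplex x -> simplex y -> (forall i, m <= x i 0) -> (forall i, m <= y i 0) ->
  \sum_(i < d) z i 0 = 0 -> slope eta rs y z = 0 ->
  `|slope eta rs x z| <=
    (2 * (d%:R / eta + (size os)%:R) / m + 8 * d%:R ^+ 2) * norm2 z.
Proof.
move=> rp hrs hqs sq xs ys xm ym z0 sy.
have hos : all_simplex os.
  by move=> r ro; apply: hrs; rewrite (perm_mem rp) mem_cat ro.
have spl u : slope eta rs u z = slope eta os u z + \sum_(q <- qs) dot z q / dot u q.
  by rewrite /slope /barrier_sum (perm_big _ rp) big_cat/= addrA.
have -> : slope eta rs x z = slope eta os x z - slope eta os y z +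
    \sum_(q <- qs) (dot z q / dot x q - dot z q / dot y q).
  rewrite sumrB; have := spl x; have := spl y; rewrite sy => e1 e2.
  by move: e1 e2; lra.
have bx := slope_coord_ge_bound z xm hos; have b_y := slope_coord_ge_bound z ym hos.
have bq : `|\sum_(q <- qs) (dot z q / dot x q - dot z q / dot y q)| <=
    8 * d%:R ^+ 2 * norm2 z.
  apply: le_trans (ler_norm_sum _ _ _) _.
  apply: (@le_trans _ _ (\sum_(q <- qs) 8 * d%:R ^+ 2 * tau ^+ 2 * norm2 z)).
    rewrite big_seq [leRHS]big_seq; apply: ler_sum => q /hqs[qS qc].
    exact: close_slope_diff.
  rewrite big_const_seq count_predT iter_addr_0 -[leLHS]mulr_natl.
  have -> : (size qs)%:R * (8 * d%:R ^+ 2 * tau ^+ 2 * norm2 z) =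
    (size qs)%:R * tau ^+ 2 * (8 * d%:R ^+ 2 * norm2 z) by ring.
  by rewrite ler_piMl// mulr_ge0 ?norm2_ge0// mulr_ge0// sqr_ge0.
apply: le_trans (ler_normD _ _) _; rewrite [leRHS]mulrDl; apply: lerD => //.
apply: le_trans (ler_normB _ _) _; apply: le_trans (lerD bx b_y) _.
by rewrite le_eqVlt; apply/orP; left; apply/eqP; ring.
Qed.

End SlopeBound.

(** * Regret as an accumulation of potential gaps *)

Section LossAccounting.
Context {R : realType} {d : nat}.
Variable eta : R.
Hypotheses (eta_gt0 : 0 < eta) (d_gt0 : (0 < d)%N).
Implicit Types (x r : 'cV[R]_d) (rs : seq 'cV[R]_d).

Definition ftrl_loss rs : R :=
  \sum_(t < size rs) - ln (dot (lb_ftrl eta (take t rs)) rs`_t).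

Definition min_potential rs := real_potential eta rs (lb_ftrl eta rs).

Lemma ftrl_loss_rcons rs r :
  ftrl_loss (rcons rs r) = ftrl_loss rs - ln (dot (lb_ftrl eta rs) r).
Proof.
rewrite /ftrl_loss size_rcons big_ord_recr/= nth_rcons ltnn eqxx.
rewrite -cats1 take_size_cat//; congr (_ - _).
by apply: eq_bigr => t _; rewrite takel_cat ?(ltnW (ltn_ord t))// nth_cat ltn_ord.
Qed.

Lemma real_potential_rcons rs r x :
  real_potential eta (rcons rs r) x = real_potential eta rs x - ln (dot x r).
Proof. by rewrite /real_potential big_rcons/= addrA opprD. Qed.

Lemma min_potential_rcons rs r : all_simplex rs -> simplex r ->
  min_potential (rcons rs r) <= min_potential rs - ln (dot (lb_ftrl eta rs) r).
Proof.
move=> hrs hr; have [xs x0 _] := lb_ftrlP eta_gt0 d_gt0 hrs.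
rewrite -real_potential_rcons.
by apply: lb_ftrl_min => //; exact: all_simplex_rcons.
Qed.

(** The increment is Phi_{t+1}(x_t) - min Phi_{t+1}. *)
Lemma ftrl_loss_sub_rcons rs r : all_simplex rs -> simplex r ->
  ftrl_loss rs - min_potential rs <=
  ftrl_loss (rcons rs r) - min_potential (rcons rs r).
Proof.
move=> hrs hr; rewrite ftrl_loss_rcons -addrA lerD2l -opprD lerN2 addrC -lerBrDr.
exact: min_potential_rcons.
Qed.

(* Comparing with the next iterate [lb_ftrl eta rs], whose cumulative loss is at
   most its potential minus that of the initial iterate. *)
Lemma regret_ge rs : all_simplex rs ->
  ((ftrl_loss rs - min_potential rs + min_potential [::])%:E <= regret eta rs)%E.
Proof.
move=> hrs; have [us u0 _] := lb_ftrlP eta_gt0 d_gt0 hrs.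
set u := lb_ftrl eta rs in us u0 *.
have h0 : all_simplex ([::] : seq 'cV[R]_d) by [].
have m0 := lb_ftrl_min eta_gt0 d_gt0 h0 us u0.
apply: (@le_trans _ _ (\sum_(t < size rs)
  (loss rs`_t (lb_ftrl eta (take t rs)) - loss rs`_t u))%E); last first.
  by apply: ereal_sup_ubound; exists u.
have -> : (\sum_(t < size rs) (loss rs`_t (lb_ftrl eta (take t rs)) - loss rs`_t u) =
   (\sum_(t < size rs) (- ln (dot (lb_ftrl eta (take t rs)) rs`_t) + ln (dot u rs`_t)))%:E)%E.
  rewrite -sumEFin; apply: eq_bigr => t _.
  have rt : simplex rs`_t by apply: hrs; rewrite mem_nth.
  have [_ x0 _] := @lb_ftrlP R d eta eta_gt0 d_gt0 (take t rs) (fun q qt => hrs q (mem_take qt)).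
  by rewrite !lossE// -EFinN -EFinD opprK.
rewrite lee_fin big_split/= -/(ftrl_loss rs) -addrA lerD2l.
have -> : \sum_(t < size rs) ln (dot u rs`_t) = \sum_(r <- rs) ln (dot u r).
  by rewrite [RHS](big_nth 0) big_mkord.
move: m0; rewrite /min_potential -/u {2 3}/real_potential big_nil addr0.
lra.
Qed.

End LossAccounting.

(** * Simulation of the procedure *)

Section Simulation.
Context {R : realType} {d N : nat}.
Variables (eta L : R) (V : 'M[R]_(d, d.-1)) (T : nat) (tgt orc : 'I_N -> 'cV[R]_d).
Hypotheses (eta_gt0 : 0 < eta) (d_ge2 : (2 <= d)%N) (L_gt0 : 0 < L).
Hypothesis V_basis : orthonormal_basis_centroid_compl V.
Hypotheses (tgt_simplex : forall i, simplex (tgt i)).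
Hypotheses (orc_simplex : forall i, simplex (orc i)).
Hypothesis tgt_orc_lt : forall i j : 'I_N, (j < i)%N -> L <= dot (tgt i) (orc j).
Hypothesis tgt_orc_eq0 : forall i, dot (tgt i) (orc i) = 0.

Definition mix_eps s : R := 2 ^+ s * T%:R `^ (- alpha R).

Lemma mixE s (x : 'cV[R]_d) : mix T s x = centroid_mix (mix_eps s) x.
Proof. by rewrite /mix /mix_coef subKr. Qed.

(* Schedule entries tagged with the index [k] of the pass they belong to. *)
Variable plan : seq ('I_N * nat * nat).
Implicit Types (q : 'I_N * nat * nat) (done todo : seq ('I_N * nat * nat)).
Definition drop_pass q : 'I_N * nat := (q.1.1, q.2).
Variables (eps0 : R) (M : nat).
Let tau : R := T%:R `^ (- 2^-1).
Hypotheses (tau_gt0 : 0 < tau) (taule : tau <= (2 * d%:R)^-1).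
Hypothesis T_tau : T%:R * tau ^+ 2 <= 1.
Hypothesis eps0_gt0 : 0 < eps0.
Hypothesis plan_schedule : schedule R N T = map drop_pass plan.
Hypothesis plan_eps : forall q, q \in plan -> eps0 <= mix_eps q.2 <= 2^-1.
Hypothesis plan_ge1 : forall q, q \in plan -> (1 <= q.1.2)%N /\ (1 <= q.2)%N.
Hypothesis plan_small : forall q, q \in plan ->
  (size plan)%:R * (16 * (mix_eps q.2 / L) ^+ 2) <= 1 /\
  16 * (d%:R * mix_eps q.2) ^+ 2 <= 1.
Hypothesis plan_prefix : forall done q todo, plan = done ++ q :: todo ->
  (forall q', q' \in done -> (q'.1.1 <= q.1.1)%N) /\
  \sum_(q' <- done | q'.1.1 == q.1.1)
    (mix_eps q.2 / (mix_eps q.2 + mix_eps q'.2)) ^+ 2 <= (q.1.2 * q.2.+1)%:R.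
(** Bound on the projected gradient at the start of a while loop. Each move lowers the norm by [tau]
    or makes it 0, so [M] moves are enough. *)
Let G0 : R := 2 * (d%:R / eta + (size plan)%:R) / (eps0 / d%:R) + 8 * d%:R ^+ 2.
Hypothesis M_ge : G0 <= M%:R * tau.
Hypothesis plan_time : (size plan * M.+1 <= T)%N.

Let d_gt0 : (0 < d)%N. Proof. exact: ltn_trans d_ge2. Qed.
Let dp : 0 < d%:R :> R. Proof. by rewrite ltr0n. Qed.

(** The gain of [oracle_round_gain] with K = (k + d / eta) s. *)
Definition plan_gain q : R := (16 * (320 * ((q.1.2%:R + d%:R / eta) * q.2%:R)))^-1.

Let target q : 'cV[R]_d := target_point mix_eps tgt (drop_pass q).
Let oracle q : 'cV[R]_d := oracle_return mix_eps orc (drop_pass q).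
Let grad rs q := proj_gradient eta V rs (target q).

Lemma plan_eps01 q : q \in plan -> 0 <= mix_eps q.2 <= 1.
Proof. by move=> /plan_eps/andP[e0 e1]; apply/andP; have := eps0_gt0; split; lra. Qed.

Lemma target_simplex q : q \in plan -> simplex (target q).
Proof. by move=> /plan_eps01 e; exact: centroid_mix_simplex. Qed.

Lemma oracle_simplex q : q \in plan -> simplex (oracle q).
Proof. by move=> /plan_eps01 e; exact: centroid_mix_simplex. Qed.

Lemma target_coord_ge q i : q \in plan -> eps0 / d%:R <= target q i 0.
Proof.
move=> qp; have e := plan_eps01 qp.
apply: le_trans (centroid_mix_coord_ge i e (tgt_simplex _)).
by have /andP[? _] := plan_eps qp; rewrite ler_wpM2r// invr_ge0 ltW.
Qed.

Let m_gt0 : 0 < eps0 / d%:R. Proof. by rewrite divr_gt0. Qed.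

Lemma target_positive q : q \in plan -> positive_vec (target q).
Proof. by move=> qp i; exact: lt_le_trans (target_coord_ge i qp). Qed.

(** Invariant of the rounds. [qs] collects the returns outside oracle rounds, and [m] counts the
    moves of the current while loop. The bound on the length of [rs] allots M + 1 rounds to each
    finished entry; the gradient at the current target is 0 or has norm at most G0 - m tau. *)
Definition sim_state (rs : seq 'cV[R]_d) done todo qs (m : nat) : Prop :=
  [/\ plan = done ++ todo,
      perm_eq rs (map oracle done ++ qs), all_simplex rs &
      close_returns tau qs] /\
  [/\ (size qs <= size rs)%N,
      \sum_(q <- done) plan_gain q <=
        ftrl_loss eta rs - min_potential eta rs + min_potential eta ([::] : seq 'cV[R]_d) &
      forall q todo', todo = q :: todo' ->
        [/\ (size rs <= size done * M.+1 + m)%N, (m <= M)%N &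
            grad rs q = 0 \/ norm2 (grad rs q) + m%:R * tau <= G0]].

Lemma initial_gradient_le q : q \in plan -> norm2 (grad [::] q) <= G0.
Proof.
move=> qp; have h0 : all_simplex ([::] : seq 'cV[R]_d) by [].
have GE : d%:R / eta / (eps0 / d%:R) <= G0.
  have a0 : 0 <= d%:R / eta / (eps0 / d%:R) by rewrite !divr_ge0 ?ltW.
  have b0 : 0 <= (size plan)%:R / (eps0 / d%:R) by rewrite divr_ge0// ltW.
  have c0 : 0 <= 8 * d%:R ^+ 2 :> R by rewrite mulr_ge0// sqr_ge0.
  rewrite /G0 mulrDr mulrDl -!mulrA in a0 b0 c0 *; lra.
apply: le_trans GE; apply: norm2_proj_gradient_le => //.
- exact: target_positive.
- by rewrite !divr_ge0 ?ltW.
move=> z _.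
have := @slope_coord_ge_bound _ _ eta _ eta_gt0 m_gt0 [::] (target q) z _ h0.
by rewrite addr0; apply => i; exact: target_coord_ge.
Qed.

(** The oracle round starts at the minimizer [target q], where the slope is 0. [slope_transfer]
    carries this to the next target, and the new oracle return adds one more term; [size done] + 1
    is at most [size plan]. *)
Lemma gradient_after_oracle rs done q q' todo qs :
  plan = done ++ [:: q, q' & todo] -> perm_eq rs (map oracle done ++ qs) ->
  all_simplex rs -> close_returns tau qs -> (size qs)%:R * tau ^+ 2 <= 1 ->
  lb_ftrl eta rs = target q -> norm2 (grad (rcons rs (oracle q)) q') <= G0.
Proof.
move=> pE rp hrs hqs sq lbE.
have qp : q \in plan by rewrite pE mem_cat mem_head orbT.
have qp' : q' \in plan by rewrite pE mem_cat !in_cons eqxx !orbT.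
have oS := oracle_simplex qp.
apply: norm2_proj_gradient_le => //.
- exact: target_positive.
- exact: all_simplex_rcons.
- exact: le_trans (norm2_ge0 _) (initial_gradient_le qp).
move=> z z0; rewrite /slope barrier_sum_rcons; apply: le_trans (ler_normD _ _) _.
have tc i := target_coord_ge i qp'.
have h1 := dot_div_le m_gt0 z tc oS.
have h2 : `|slope eta rs (target q') z| <=
    (2 * (d%:R / eta + (size done)%:R) / (eps0 / d%:R) + 8 * d%:R ^+ 2) * norm2 z.
  rewrite -(size_map oracle).
  apply: (slope_transfer (y := target q) eta_gt0 d_ge2 m_gt0 taule rp) => //.
  - exact: target_simplex.
  - exact: target_simplex.
  - by move=> i; exact: target_coord_ge.
  - by rewrite -lbE slope_lb_ftrl.
apply: le_trans (lerD h2 h1) _.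
have sz : (size done)%:R + 1 <= (size plan)%:R :> R.
  by rewrite natr1 ler_nat pE size_cat/= !addnS ltnS leqW// leq_addr.
have n0 := norm2_ge0 z.
rewrite [norm2 z / _]mulrC -mulrDl; apply: ler_wpM2r => //.
have i0 : 0 < (eps0 / d%:R)^-1 by rewrite invr_gt0.
rewrite /G0; set c := (eps0 / d%:R)^-1 in i0 *.
have : ((size done)%:R + 1) * c <= (size plan)%:R * c by rewrite ler_pM2r.
have : 0 <= (size plan)%:R * c by rewrite mulr_ge0// ltW.
have : 0 <= (size done)%:R * c by rewrite mulr_ge0// ltW.
rewrite !mulrDr !mulrDl; lra.
Qed.

Lemma oracle_loss_gain rs done q todo qs :
  plan = done ++ q :: todo -> perm_eq rs (map oracle done ++ qs) ->
  all_simplex rs -> close_returns tau qs -> (size qs)%:R * tau ^+ 2 <= 1 ->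
  lb_ftrl eta rs = target q ->
  min_potential eta (rcons rs (oracle q)) <=
  min_potential eta rs - ln (dot (lb_ftrl eta rs) (oracle q)) - plan_gain q.
Proof.
move=> pE rp hrs hqs sq lbE.
have qp : q \in plan by rewrite pE mem_cat mem_head orbT.
have [pre1 pre2] := plan_prefix pE.
have [sm1 sm2] := plan_small qp; have [k1 s1] := plan_ge1 qp.
have /andP[e0 e1] := plan_eps qp.
have rp' : perm_eq rs (map (oracle_return mix_eps orc) (map drop_pass done) ++ qs).
  by rewrite -map_comp.
have kR : 1 <= q.1.2%:R :> R by rewrite ler1n.
have sR : 1 <= q.2%:R :> R by rewrite ler1n.
have de0 : 0 <= d%:R / eta by rewrite divr_ge0 ?ltW.
have ks : 1 <= q.1.2%:R * q.2%:R :> R by rewrite -natrM ler1n muln_gt0 k1.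
have ds : d%:R / eta <= d%:R / eta * q.2%:R by rewrite ler_peMr.
set K := (q.1.2%:R + d%:R / eta) * q.2%:R.
have K1 : 1 <= K by rewrite /K mulrDl; lra.
have rho0 : 0 <= (320 * K)^-1 by rewrite invr_ge0; exact: mulr_ge0 (ler0n _ _) (le_trans ler01 K1).
rewrite /min_potential lbE /plan_gain -/K.
have dE p : p \in map drop_pass done -> (p.1 <= q.1.1)%N /\ 0 < mix_eps p.2 <= 2^-1.
  move=> /mapP[q' q'd ->]; split; first exact: pre1.
  have /plan_eps/andP[h1 ->] : q' \in plan by rewrite pE mem_cat q'd.
  by rewrite (lt_le_trans eps0_gt0).
have dsz : (size (map drop_pass done))%:R * (16 * (mix_eps q.2 / L) ^+ 2) <= 1.
  rewrite size_map; apply: le_trans sm1; apply: ler_wpM2r.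
    by rewrite mulr_ge0// sqr_ge0.
  by rewrite ler_nat pE size_cat leq_addr.
(* The damped sum is at most k (s + 1) by [plan_prefix], and 4 k (s + 1) + 2 <= 10 k s because k and
   s are at least 1. *)
have B_le : d%:R / eta + 4 * (\sum_(p <- map drop_pass done | p.1 == q.1.1)
    (mix_eps q.2 / (mix_eps q.2 + mix_eps p.2)) ^+ 2) + 2 <= 10 * K.
  rewrite big_map/=.
  move: pre2; rewrite natrM -natr1 mulrDr mulr1 => pre2.
  rewrite /K mulrDl.
  have : q.1.2%:R <= q.1.2%:R * q.2%:R :> R by rewrite ler_peMr.
  move: pre2; set S := \sum_(_ <- _ | _) _ => pre2; lra.
exact: (oracle_round_gain eta_gt0 d_gt0 L_gt0
  tgt_simplex orc_simplex tgt_orc_lt tgt_orc_eq0 (lt_le_trans eps0_gt0 e0) e1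
  rho0 rp' dE taule hqs sq dsz sm2 hrs lbE K1 B_le erefl).
Qed.

Lemma simulation t : (t <= T)%N -> exists done todo qs m,
  let rs := (procedure T eta V tgt orc t).1 in
  [/\ size rs = t, (procedure T eta V tgt orc t).2 = map drop_pass todo &
      sim_state rs done todo qs m].
Proof.
elim: t => [_|t IH tT].
  exists [::], plan, [::], 0%N => /=; split=> //.
  split; first by split.
  split=> //; first by rewrite big_nil /ftrl_loss big_ord0 add0r addNr.
  move=> q todo pE; split=> //; right; rewrite mul0r addr0.
  by apply: initial_gradient_le; rewrite pE mem_head.
have [done [todo [qs [m]]]] := IH (ltnW tT).
rewrite /=; case: (procedure _ _ _ _ _ t) => rs todo1 /=.
move=> [st -> [[pE rp hrs hqs] [qsz gain prog]]].
have sq : (size qs)%:R * tau ^+ 2 <= 1.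
  apply: le_trans T_tau; rewrite ler_wpM2r ?sqr_ge0// ler_nat.
  by rewrite (leq_trans qsz)// st ltnW.
have perm_r r : perm_eq (rcons rs r) (map oracle done ++ rcons qs r).
  by rewrite -!cats1 catA perm_cat2r.
(* When the schedule is exhausted, the centroid counts as a close return and the regret bound does
   not decrease. *)
case: todo => [|q todo] in pE prog *.
  exists done, [::], (rcons qs (centroid R d)), m => /=.
  have cS := @centroid_simplex R d d_gt0.
  split; [by rewrite size_rcons st|by []|].
  split; first split=> //.
  - exact: all_simplex_rcons.
  - move=> r; rewrite mem_rcons in_cons => /orP[/eqP->|/hqs//]; split=> //.
    by rewrite subrr /norm2 /dot big1 ?sqrtr0 ?ltW// => i _; rewrite mxE mul0r.
  split; [by rewrite !size_rcons| |by move=> q todo' []].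
  by apply: le_trans gain _; rewrite lerD2r ftrl_loss_sub_rcons.
have [tle mM gq] := prog q todo erefl.
have qp : q \in plan by rewrite pE mem_cat mem_head orbT.
have tqE : mix T q.2 (tgt q.1.1) = target q by rewrite mixE.
rewrite /= tqE; case: eqVneq => [lbE|lbN] /=.
  (* Oracle round: the entry passes to [done], its gain is added, and the move counter restarts at
     0. *)
  have oE : mix T q.2 (orc q.1.1) = oracle q by rewrite mixE.
  rewrite oE; exists (rcons done q), todo, qs, 0%N.
  have oS := oracle_simplex qp.
  split; [by rewrite size_rcons st|by []|].
  split; first split=> //.
  - by rewrite cat_rcons.
  - rewrite map_rcons cat_rcons -cat1s perm_sym perm_catCA/= perm_sym.
    by rewrite perm_rcons perm_cons.
  - exact: all_simplex_rcons.
  split; first by rewrite size_rcons ltnW.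
    rewrite -cats1 big_cat big_seq1/= ftrl_loss_rcons.
    have := oracle_loss_gain pE rp hrs hqs sq lbE; move: gain; lra.
  move=> q' todo' todoE; split => //.
    by rewrite !size_rcons addn0 mulSn addSn ltnS (leq_trans tle)// addnC leq_add2r.
  right; rewrite mul0r addr0.
  by rewrite todoE in pE; exact: gradient_after_oracle pE rp hrs hqs sq lbE.
have tS := target_simplex qp; have tP := target_positive qp.
have g0 : grad rs q != 0.
  apply/eqP => g0; move/eqP: lbN; apply.
  exact: (lb_ftrl_proj_gradient0 eta_gt0 d_ge2 V_basis hrs tS tP).
set r := move _ _ _ _.
have [rS rc rg] := move_step d_ge2 V_basis tau_gt0 taule hrs tS tP g0.
rewrite -/r in rS rc rg.
exists done, (q :: todo), (rcons qs r), m.+1.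
split; [by rewrite size_rcons st|by []|].
split; first split=> //.
- exact: all_simplex_rcons.
- by move=> r'; rewrite mem_rcons in_cons => /orP[/eqP->|/hqs].
split; first by rewrite !size_rcons.
  by apply: le_trans gain _; rewrite lerD2r ftrl_loss_sub_rcons.
move=> _ _ [<- _].
have {}gq : norm2 (grad rs q) + m%:R * tau <= G0.
  by case: gq => // g00; rewrite g00 eqxx in g0.
have gp := norm2_gt0 g0.
split.
- by rewrite size_rcons addnS ltnS.
(* The gradient was still nonzero before this move, so m tau < G0 <= M tau, which leaves room for
   one more. *)
- rewrite -(ltr_nat R) -(ltr_pM2r tau_gt0); apply: lt_le_trans M_ge.
  by apply: lt_le_trans gq; rewrite ltrDr.
case: rg => [g1|]; first by left.
rewrite lerBrDr => rg; right; apply: le_trans gq.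
by rewrite -natr1 mulrDl mul1r addrCA addrC lerD2r.
Qed.

(** An unfinished schedule after round T would mean T <= [size done] (M + 1) + M < [size plan] (M +
    1) <= T. *)
Lemma simulated_regret_ge :
  ((\sum_(q <- plan) plan_gain q)%:E <=
    regret eta (generated_returns T eta V tgt orc))%E.
Proof.
have [done [todo [qs [m]]]] := simulation (leqnn T).
rewrite /generated_returns; set rs := (procedure _ _ _ _ _ _).1.
move=> [sT _ [[pE rp hrs hqs] [_ gain prog]]].
case: todo => [|q todo] in pE prog.
  apply: le_trans (regret_ge eta_gt0 d_gt0 hrs).
  by rewrite lee_fin pE cats0.
have [tle mM _] := prog q todo erefl.
exfalso; move: plan_time; apply/negP; rewrite -ltnNge -{1}sT.
apply: (leq_ltn_trans tle); rewrite pE size_cat/= addnS mulSn addnC.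
by rewrite -addSn leq_add// leq_mul2r leq_addr orbT.
Qed.

End Simulation.

(** * Schedule and sums *)

Section Plan.
Context {N : nat}.
Variables (Kt S : nat).

(** Same order as [schedule], with the index k kept because the gain of an oracle round depends on
    it. *)
Definition tagged_schedule : seq ('I_N * nat * nat) :=
  flatten [seq [seq (i, k, s) | k <- iota 1 Kt, s <- iota 1 S] | i <- enum 'I_N].

Lemma pairwise_flatten_map (I A : eqType) (e : rel I) (r : rel A) (f : I -> seq A) l :
  pairwise e l -> (forall i, i \in l -> pairwise r (f i)) ->
  (forall i j x y, e i j -> x \in f i -> y \in f j -> r x y) ->
  pairwise r (flatten (map f l)).
Proof.
move=> el rf ref; elim: l el rf => //= i l IH /andP[ei el] rf.
rewrite pairwise_cat rf ?mem_head//= IH//; last first.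
  by move=> j jl; apply: rf; rewrite in_cons jl orbT.
rewrite andbT; apply/allrelP => x y xi /flattenP[_ /mapP[j jl ->] yj].
exact: (ref i j) (allP ei _ jl) xi yj.
Qed.

Let before (q' q : 'I_N * nat * nat) : bool :=
  (q'.1.1 < q.1.1)%N || (q'.1.1 == q.1.1) && (q'.1.2 <= q.1.2)%N.

Lemma tagged_schedule_pairwise : pairwise before tagged_schedule.
Proof.
apply: (@pairwise_flatten_map _ _ (fun i j : 'I_N => (i < j)%N)).
- rewrite -(pairwise_map val ltn) val_enum_ord -sorted_pairwise ?iota_ltn_sorted//.
  exact: ltn_trans.
- move=> i _; apply: (@pairwise_flatten_map _ _ ltn).
  + by rewrite -sorted_pairwise ?iota_ltn_sorted//; exact: ltn_trans.
  + move=> k _; rewrite pairwise_map; apply/(pairwiseP 0%N) => x y _ _ _.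
    by rewrite /before/= eqxx leqnn orbT.
  + move=> k k' x y kk' /mapP[s _ ->] /mapP[s' _ ->].
    by rewrite /before/= eqxx; apply/orP; right; exact: ltnW.
- move=> i j x y ij /allpairsP[[k s] [_ _ ->]] /allpairsP[[k' s'] [_ _ ->]].
  by rewrite /before/= ij.
Qed.

Lemma mem_tagged_schedule q : q \in tagged_schedule ->
  (1 <= q.1.2 <= Kt)%N /\ (1 <= q.2 <= S)%N.
Proof.
move=> /flattenP[_ /mapP[i _ ->] /allpairsP[[k s] [/= ki si ->]]].
by move: ki si; rewrite !mem_iota !add1n !ltnS.
Qed.

Lemma size_tagged_schedule : size tagged_schedule = (N * (Kt * S))%N.
Proof.
rewrite size_flatten /shape -map_comp.
rewrite (eq_map (g := fun _ => (Kt * S)%N)); last first.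
  by move=> i /=; rewrite size_allpairs !size_iota.
by rewrite sumnE big_map big_enum/= sum_nat_const card_ord.
Qed.

Lemma tagged_schedule_prefix done q todo : tagged_schedule = done ++ q :: todo ->
  forall q', q' \in done -> before q' q.
Proof.
move=> tE q' q'd; have := tagged_schedule_pairwise.
rewrite tE pairwise_cat => /andP[/allrelP h _].
by apply: h => //; exact: mem_head.
Qed.

Lemma sum_tagged_schedule (R : realType) (F : 'I_N * nat * nat -> R) :
  \sum_(q <- tagged_schedule) F q =
  \sum_(i < N) \sum_(1 <= k < Kt.+1) \sum_(1 <= s < S.+1) F (i, k, s).
Proof.
rewrite big_flatten big_map big_enum/=; apply: eq_bigr => i _.
rewrite big_allpairs_dep/= /index_iota !subSS !subn0.
by apply: eq_bigr => k _.
Qed.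

(** Entries of the same target that precede [q] lie in the passes 1, ..., k, where k is the pass of
    [q]. The current pass is counted in full, and each pass costs at most [B]. *)
Lemma sum_prefix_le (R : realType) (F : nat -> R) (B : R) done q todo :
  (forall s, 0 <= F s) -> tagged_schedule = done ++ q :: todo ->
  \sum_(1 <= s < S.+1) F s <= B ->
  \sum_(q' <- done | q'.1.1 == q.1.1) F q'.2 <= q.1.2%:R * B.
Proof.
move=> F0 tE FB; have /mem_tagged_schedule[/andP[k1 kK] _] : q \in tagged_schedule.
  by rewrite tE mem_cat mem_head orbT.
pose G (q' : 'I_N * nat * nat) : R :=
  if (q'.1.1 == q.1.1) && (q'.1.2 <= q.1.2)%N then F q'.2 else 0.
have G0 q' : 0 <= G q' by rewrite /G; case: ifP.
apply: (@le_trans _ _ (\sum_(q' <- tagged_schedule) G q')).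
  rewrite tE big_cat/= -[leLHS]addr0; apply: lerD; last by apply: sumr_ge0.
  rewrite big_mkcond big_seq [leRHS]big_seq; apply: ler_sum => q' q'd.
  rewrite /G; case: ifP => // ii.
  have := tagged_schedule_prefix tE q'd.
  by rewrite /before (eqP ii) ltnn eqxx/= => ->.
rewrite sum_tagged_schedule (bigD1 q.1.1)//= [X in _ + X]big1 ?addr0; last first.
  move=> i iq; rewrite big1// => k _; rewrite big1// => s _.
  by rewrite /G/= (negbTE iq).
rewrite (big_cat_nat (n := q.1.2.+1))//= [X in _ + X]big_nat [X in _ + X]big1 ?addr0.
  have -> : q.1.2%:R * B = \sum_(1 <= k < q.1.2.+1) B.
    by rewrite big_const_nat iter_addr_0 subSS subn0 mulr_natl.
  rewrite big_nat [leRHS]big_nat; apply: ler_sum => k /andP[_ kq].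
  apply: le_trans FB; rewrite le_eqVlt; apply/orP; left; apply/eqP.
  by apply: eq_bigr => s _; rewrite /G/= eqxx -ltnS kq.
move=> k /andP[kq _]; rewrite big1// => s _.
by rewrite /G/= leqNgt kq andbF.
Qed.

End Plan.

Lemma schedule_tagged (R : realType) (N T : nat) :
  schedule R N T = map (@drop_pass N)
    (tagged_schedule (Num.truncn (T%:R `^ alpha R : R))
       (Num.truncn (3^-1 * alpha R * (ln T%:R / ln 2) : R))).
Proof.
rewrite /schedule /tagged_schedule map_flatten -[in RHS]map_comp; congr flatten.
apply: eq_map => i; rewrite /= map_flatten -[in RHS]map_comp; congr flatten.
by apply: eq_map => k /=; rewrite -map_comp.
Qed.

(** * Geometric and harmonic sums *)

Section Sums.
Context {R : realType}.

(** Levels j <= s count 1 each, as the subtraction is truncated; the higher ones form a geometric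
    series of sum at most 1. *)
Lemma sum_halves_le (S s : nat) :
  \sum_(1 <= j < S.+1) (2^-1 : R) ^+ (j - s) <= s.+1%:R.
Proof.
(* Adding the remainder of the geometric series makes the induction go through. *)
suff h : \sum_(1 <= j < S.+1) (2^-1 : R) ^+ (j - s) + 2^-1 ^+ (S - s) <= (minn S s).+1%:R.
  have : 0 <= (2^-1 : R) ^+ (S - s) by rewrite exprn_ge0.
  have : (minn S s).+1%:R <= s.+1%:R :> R by rewrite ler_nat ltnS geq_minr.
  by move: h; lra.
elim: S => [|S IH]; first by rewrite big_geq// sub0n expr0 min0n add0r.
rewrite big_nat_recr//=; have [sS|Ss] := leqP s S.
  rewrite (minn_idPr (leqW sS)); rewrite (minn_idPr sS) in IH.
  by apply: le_trans IH; rewrite subSn// exprS; lra.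
rewrite (minn_idPl Ss); rewrite (minn_idPl (ltnW Ss)) in IH.
have -> : (S.+1 - s = 0)%N by apply/eqP; rewrite subn_eq0.
have e0 : (S - s = 0)%N by apply/eqP; rewrite subn_eq0 ltnW.
by rewrite e0 expr0 in IH *; rewrite -[S.+2%:R]natr1; lra.
Qed.

(** The factor T^(-alpha) cancels, and the square is dropped since the quotient is at most 1. For j
    > s the quotient is at most 2^(s - j). *)
Lemma mix_eps_sum_le (T S s : nat) : 0 < (T%:R : R) ->
  \sum_(1 <= j < S.+1) (mix_eps (R := R) T s / (mix_eps T s + mix_eps T j)) ^+ 2 <= s.+1%:R.
Proof.
move=> T0; apply: le_trans (sum_halves_le S s); apply: ler_sum => j _.
have w0 : 0 < (T%:R : R) `^ (- alpha R) by rewrite powR_gt0.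
have p (k : nat) : 0 < 2 ^+ k :> R by rewrite exprn_gt0.
have -> : mix_eps (R := R) T s / (mix_eps T s + mix_eps T j) = 2 ^+ s / (2 ^+ s + 2 ^+ j).
  by rewrite /mix_eps -mulrDl -mulf_div divff ?mulr1// gt_eqF.
have D : 0 < (2 : R) ^+ s + 2 ^+ j by rewrite addr_gt0.
have r0 : 0 <= (2 : R) ^+ s / (2 ^+ s + 2 ^+ j) by rewrite divr_ge0// ltW.
apply: (@le_trans _ _ ((2 : R) ^+ s / (2 ^+ s + 2 ^+ j))).
  rewrite expr2 ler_piMr// ler_pdivrMr// mul1r lerDl; exact: ltW.
rewrite ler_pdivrMr//.
have [js|sj] := leqP j s.
  have /eqP -> : (j - s == 0)%N by rewrite subn_eq0.
  by rewrite expr0 mul1r lerDl ltW.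
have -> : (2 : R) ^+ s = 2^-1 ^+ (j - s) * 2 ^+ j.
  by rewrite -{2}(subnK (ltnW sj)) exprD mulrA -exprMn mulVf ?expr1n ?mul1r// pnatr_eq0.
by rewrite -[in leRHS]addrC ler_wpM2l ?exprn_ge0 ?invr_ge0// lerDl mulr_ge0// ?exprn_ge0 ?invr_ge0.
Qed.

(** Telescoping, with ln (1 + u) <= u at u = 1 / (n + 1 + D). *)
Lemma sum_inv_ge (n : nat) (D : R) : 0 <= D ->
  ln (n%:R + 1 + D) - ln (1 + D) <= \sum_(1 <= k < n.+1) (k%:R + D)^-1.
Proof.
move=> D0; elim: n => [|n IH]; first by rewrite big_geq// add0r subrr.
rewrite big_nat_recr//=.
have n0 : 0 <= n%:R :> R by [].
have h : ln (n.+1%:R + 1 + D) <= ln (n%:R + 1 + D) + (n.+1%:R + D)^-1.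
  have a0 : 0 < n%:R + 1 + D by lra.
  have -> : n.+1%:R + 1 + D = (n%:R + 1 + D) * (1 + (n.+1%:R + D)^-1).
    by rewrite -natr1; field; lra.
  have i0 : 0 < (n.+1%:R + D)^-1 by rewrite invr_gt0 -natr1.
  rewrite lnM ?posrE//; last by lra.
  by rewrite lerD2l le_ln1Dx//; lra.
by move: h IH; lra.
Qed.

End Sums.

(** * Choice of scales *)

Lemma sqr_le_exp2 (n : nat) : (n ^ 2 <= 4 * 2 ^ n)%N.
Proof.
case: n => [|[|[|n]]] //; elim: n => // n IH.
by rewrite [(2 ^ _)%N]expnS mulnCA; apply: leq_trans (leq_mul (leqnn 2) IH); lia.
Qed.

Section Scales.
Context {R : realType} {d N : nat}.
Variables (eta L : R) (V : 'M[R]_(d, d.-1)) (T : nat) (tgt orc : 'I_N -> 'cV[R]_d).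
Variable p : R.
Hypotheses (eta_gt0 : 0 < eta) (d_ge2 : (2 <= d)%N) (L_gt0 : 0 < L).
Hypotheses (Tp : T%:R = p ^+ 48) (p_ge : 64 <= p) (p_geN : 64 * N%:R <= p).
Hypotheses (p_ged : 64 * d%:R <= p) (p_geD : d%:R / eta + 1 <= p).
Hypotheses (p_geL : 32 * N%:R <= p * L ^+ 2) (T_large : 576 <= ln (T%:R : R)).

Let p_gt0 : 0 < p. Proof. by apply: lt_le_trans p_ge. Qed.
Let p_ge1 : 1 <= p. Proof. by apply: le_trans p_ge; rewrite ler1n. Qed.
Let Kt := Num.truncn (T%:R `^ alpha R).
Let S := Num.truncn (3^-1 * alpha R * (ln T%:R / ln 2)).
Let n := (N * (Kt * S))%N.

(** With p = T^(1/48) all scales become integer powers: T^(1/8) = p^6, T^(1/2) = p^24, and 2^S is at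
    most T^(1/24) = p^2. *)
Lemma powR_scale (k : nat) (a : R) : 48 * a = k%:R -> T%:R `^ a = p ^+ k.
Proof.
by move=> ak; rewrite Tp -powR_mulrn ?ltW// -powRrM ak powR_mulrn// ltW.
Qed.

Lemma powRN_scale (k : nat) (a : R) : 48 * a = k%:R -> T%:R `^ (- a) = (p ^+ k)^-1.
Proof. by move=> ak; rewrite powRN (powR_scale ak). Qed.

Lemma alpha_scale : 48 * alpha R = 6%:R.
Proof. by rewrite /alpha; field. Qed.

Lemma tau_scale : T%:R `^ (- 2^-1) = (p ^+ 24)^-1.
Proof. by apply: powRN_scale; field. Qed.

Lemma mix_eps_scale s : mix_eps (R := R) T s = 2 ^+ s / p ^+ 6.
Proof. by rewrite /mix_eps (powRN_scale alpha_scale). Qed.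

Lemma ln_scale : ln (T%:R : R) = 48 * ln p.
Proof. by rewrite Tp lnXn// -[LHS]mulr_natl. Qed.

Lemma ln2_gt0 : 0 < ln (2 : R).
Proof. by rewrite ln_gt0// ltr1n. Qed.

Lemma S_arg : 3^-1 * alpha R * (ln (T%:R : R) / ln 2) = 2 * ln p / ln 2.
Proof. by rewrite ln_scale /alpha; field; rewrite gt_eqF// ln2_gt0. Qed.

Lemma ln_p_ge : 12 <= ln p.
Proof. by have := T_large; rewrite ln_scale; lra. Qed.

Lemma exp2S_le : 2 ^+ S <= p ^+ 2.
Proof.
have l2 := ln2_gt0; have lp := ln_p_ge.
have a0 : 0 <= 2 * ln p / ln 2 by rewrite divr_ge0//; lra.
rewrite -ler_ln ?posrE ?exprn_gt0// !lnXn// -[ln p *+ 2]mulr_natl.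
rewrite -[ln 2 *+ S]mulr_natl -ler_pdivlMr//.
by have := truncn_le (2 * ln p / ln 2); rewrite a0 -S_arg => ->.
Qed.

(** From S^2 <= 4 * 2^S <= 4 p^2; this crude bound on a logarithm is enough. *)
Lemma S_le : S%:R <= 2 * p.
Proof.
rewrite -(ler_sqr (x := S%:R)) ?nnegrE ?mulr_ge0 ?(ltW p_gt0)//.
apply: (@le_trans _ _ (4 * 2 ^+ S)).
  by rewrite -!natrX -natrM ler_nat sqr_le_exp2.
have -> : (2 * p) ^+ 2 = 4 * p ^+ 2 by ring.
by rewrite ler_pM2l// exp2S_le.
Qed.

Lemma Kt_le : Kt%:R <= p ^+ 6.
Proof.
by rewrite -(powR_scale alpha_scale) /Kt truncn_le powR_ge0.
Qed.

Lemma n_le : n%:R <= 2 * N%:R * p ^+ 7.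
Proof.
have -> : 2 * N%:R * p ^+ 7 = N%:R * (p ^+ 6 * (2 * p)) by ring.
by rewrite /n !natrM ler_wpM2l// ler_pM// ?Kt_le ?S_le.
Qed.

Lemma ler_scale (j k : nat) : (j <= k)%N -> p ^+ j <= p ^+ k.
Proof. by move=> jk; rewrite ler_weXn2l. Qed.

Lemma d_scale : d%:R <= p / 64.
Proof. by rewrite ler_pdivlMr// mulrC. Qed.

Lemma n_scale : n%:R <= p ^+ 8 / 32.
Proof.
apply: le_trans n_le _; have -> : p ^+ 8 / 32 = 2 * (p / 64) * p ^+ 7 by field.
by rewrite ler_wpM2r ?exprn_ge0 ?(ltW p_gt0)// ler_wpM2l// ler_pdivlMr// mulrC.
Qed.

(** The bound [G0] of the simulation for [eps0] = p^(-6) and [n] entries. *)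
Definition gradient_bound : R :=
  2 * (d%:R / eta + n%:R) / ((p ^+ 6)^-1 / d%:R) + 8 * d%:R ^+ 2.

Lemma gradient_bound_ge0 : 0 <= gradient_bound.
Proof.
have P6 : 0 <= p ^+ 6 by rewrite exprn_ge0// ltW.
rewrite /gradient_bound; apply: addr_ge0; last by rewrite mulr_ge0 ?sqr_ge0.
apply: divr_ge0; first by rewrite mulr_ge0// addr_ge0// divr_ge0// ltW.
by rewrite divr_ge0// invr_ge0.
Qed.

(** Orders of the factors: p^8 for regularizer and returns, p^6 for the inverse of [eps0], p for
    d. *)
Lemma gradient_bound_le : gradient_bound <= p ^+ 15 / 256.
Proof.
have dp : 0 < d%:R :> R by rewrite ltr0n (ltn_trans _ d_ge2).
rewrite /gradient_bound invfM invrK mulrA.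
have h1 : d%:R / eta + n%:R <= p ^+ 8 / 16.
  have h : p <= p ^+ 8 / 32.
    rewrite ler_pdivlMr// exprS ler_wpM2l ?(ltW p_gt0)//.
    by have := ler_eXnr (isT : (0 < 7)%N) p_ge1; have := p_ge; lra.
  by move: h n_scale p_geD; lra.
have h2 : 2 * (d%:R / eta + n%:R) * p ^+ 6 / d%:R^-1 <= p ^+ 15 / 512.
  rewrite invrK; have -> : p ^+ 15 / 512 = 2 * (p ^+ 8 / 16) * p ^+ 6 * (p / 64) by field.
  have D0 : 0 <= d%:R / eta + n%:R by rewrite addr_ge0// divr_ge0// ltW.
  have P6 : 0 <= p ^+ 6 by rewrite exprn_ge0// ltW.
  apply: ler_pM; [by rewrite mulr_ge0// mulr_ge0|exact: ltW| |exact: d_scale].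
  by rewrite ler_wpM2r// ler_wpM2l.
have h3 : 8 * d%:R ^+ 2 <= p ^+ 15 / 512.
  apply: (@le_trans _ _ (p ^+ 2 / 512)).
    have -> : p ^+ 2 / 512 = 8 * (p / 64) ^+ 2 by field.
    by rewrite ler_wpM2l// ler_sqr ?nnegrE ?d_scale ?divr_ge0 ?ltW.
  by have := ler_scale (isT : (2 <= 15)%N); lra.
lra.
Qed.

Definition move_bound : nat := (Num.truncn (gradient_bound * p ^+ 24)).+1.

Lemma move_bound_le : move_bound%:R <= gradient_bound * p ^+ 24 + 1.
Proof.
have P24 : 0 <= p ^+ 24 by rewrite exprn_ge0// ltW.
by rewrite -natr1 lerD2r truncn_le mulr_ge0// gradient_bound_ge0.
Qed.

Lemma move_bound_ge : gradient_bound <= move_bound%:R * (p ^+ 24)^-1.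
Proof.
have P24 : 0 < p ^+ 24 by rewrite exprn_gt0.
rewrite ler_pdivlMr//; apply: ltW.
have /truncn_itv/andP[_ //] : 0 <= gradient_bound * p ^+ 24.
by rewrite mulr_ge0 ?gradient_bound_ge0// ltW.
Qed.

(** At most p^8 entries of at most p^39 rounds each, and p^47 <= T. *)
Lemma plan_time_scale : (n * move_bound.+1 <= T)%N.
Proof.
rewrite -(ler_nat R) natrM -natr1 Tp.
have P24 : 0 < p ^+ 24 by rewrite exprn_gt0.
have P8 : 0 <= p ^+ 8 by rewrite exprn_ge0// ltW.
have h1 : move_bound%:R + 1 <= p ^+ 39.
  have := move_bound_le.
  have : gradient_bound * p ^+ 24 <= p ^+ 39 / 256.
    have -> : p ^+ 39 / 256 = p ^+ 15 / 256 * p ^+ 24 by field.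
    by rewrite ler_pM2r// gradient_bound_le.
  have := ler_eXnr (isT : (0 < 39)%N) p_ge1; have := p_ge; lra.
apply: (@le_trans _ _ (p ^+ 8 * p ^+ 39)).
  apply: ler_pM => //.
  by apply: le_trans n_scale _; rewrite ler_pdivrMr// ler_peMr//; lra.
by rewrite -exprD ler_scale.
Qed.

Let plan := @tagged_schedule N Kt S.

Lemma plan_eps_scale q : q \in plan ->
  (p ^+ 6)^-1 <= mix_eps (R := R) T q.2 <= (p ^+ 4)^-1.
Proof.
move=> /mem_tagged_schedule[_ /andP[_ sS]]; rewrite mix_eps_scale.
have P (k : nat) : 0 < p ^+ k by rewrite exprn_gt0.
apply/andP; split.
  by rewrite ler_peMl ?invr_ge0 ?(ltW (P _))// exprn_ege1// ler1n.
rewrite ler_pdivrMr//; have -> : (p ^+ 4)^-1 * p ^+ 6 = p ^+ 2.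
  by rewrite -[6%N]/(4 + 2)%N exprD mulKf ?gt_eqF.
by apply: le_trans exp2S_le; rewrite ler_weXn2l// ler1n.
Qed.

Lemma plan_small_scale q : q \in plan ->
  (size plan)%:R * (16 * (mix_eps (R := R) T q.2 / L) ^+ 2) <= 1 /\
  16 * (d%:R * mix_eps (R := R) T q.2) ^+ 2 <= 1.
Proof.
move=> /plan_eps_scale/andP[e0 e1]; rewrite size_tagged_schedule -/n.
have P (k : nat) : 0 < p ^+ k by rewrite exprn_gt0.
have eg : 0 <= mix_eps (R := R) T q.2 by apply: le_trans e0; rewrite invr_ge0 ltW.
have L2 : 0 < L ^+ 2 by rewrite exprn_gt0.
have e2 : mix_eps (R := R) T q.2 ^+ 2 <= (p ^+ 8)^-1.
  have -> : (p ^+ 8)^-1 = (p ^+ 4)^-1 ^+ 2 by rewrite exprVn -exprM.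
  by rewrite ler_sqr ?nnegrE// invr_ge0 ltW.
split.
  apply: (@le_trans _ _ (2 * N%:R * p ^+ 7 * (16 * ((p ^+ 8)^-1 / L ^+ 2)))).
    apply: ler_pM => //; first by rewrite mulr_ge0// sqr_ge0.
      exact: n_le.
    by rewrite expr_div_n ler_pM2l// ler_pM2r// invr_gt0.
  (* The lower bound [p_geL] on p is what makes this at most 1. *)
  have -> : 2 * N%:R * p ^+ 7 * (16 * ((p ^+ 8)^-1 / L ^+ 2)) = 32 * N%:R / (p * L ^+ 2).
    by field; rewrite !gt_eqF.
  by rewrite ler_pdivrMr ?mul1r// mulr_gt0.
have de : d%:R * mix_eps (R := R) T q.2 <= 64^-1.
  apply: (@le_trans _ _ (p / 64 * (p ^+ 4)^-1)); first by apply: ler_pM => //; exact: d_scale.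
  rewrite ler_pdivrMr// mulrC ler_pM2l ?invr_gt0//.
  by have := ler_scale (isT : (1 <= 4)%N); rewrite expr1.
have de0 : 0 <= d%:R * mix_eps (R := R) T q.2 by rewrite mulr_ge0.
have : (d%:R * mix_eps (R := R) T q.2) ^+ 2 <= 64^-1 ^+ 2 by rewrite ler_sqr ?nnegrE.
lra.
Qed.

Lemma plan_prefix_scale done q todo : plan = done ++ q :: todo ->
  (forall q', q' \in done -> (q'.1.1 <= q.1.1)%N) /\
  \sum_(q' <- done | q'.1.1 == q.1.1)
    (mix_eps (R := R) T q.2 / (mix_eps T q.2 + mix_eps T q'.2)) ^+ 2
    <= (q.1.2 * q.2.+1)%:R.
Proof.
move=> pE; split.
  by move=> q' /(tagged_schedule_prefix pE)/orP[/ltnW//|/andP[/eqP-> _]].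
have T0 : 0 < (T%:R : R) by rewrite Tp exprn_gt0.
rewrite natrM.
pose F j := (mix_eps (R := R) T q.2 / (mix_eps T q.2 + mix_eps T j)) ^+ 2.
apply: (sum_prefix_le (F := F) _ pE).
  by move=> s; exact: sqr_ge0.
exact: mix_eps_sum_le.
Qed.

Lemma plan_gain_sum :
  \sum_(q <- plan) plan_gain (d := d) eta q =
  N%:R * (16 * 320)^-1 * (\sum_(1 <= k < Kt.+1) (k%:R + d%:R / eta)^-1)
  * (\sum_(1 <= s < S.+1) (s%:R : R)^-1).
Proof.
have gainE (i : 'I_N) :
    \sum_(1 <= k < Kt.+1) \sum_(1 <= s < S.+1) plan_gain (d := d) eta (i, k, s) =
    (16 * 320)^-1 * ((\sum_(1 <= k < Kt.+1) (k%:R + d%:R / eta)^-1)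
      * (\sum_(1 <= s < S.+1) (s%:R : R)^-1)) :> R.
  rewrite mulr_suml mulr_sumr; apply: eq_bigr => k _.
  rewrite !mulr_sumr; apply: eq_bigr => s _.
  by rewrite /plan_gain/= !invfM !mulrA.
rewrite sum_tagged_schedule; under eq_bigr do rewrite gainE.
rewrite sumr_const card_ord.
by rewrite -[LHS]mulr_natl !mulrA.
Qed.

(** From ln (T^(1/8)) = 6 ln p the offset takes away at most ln (p^3), since 1 + d / eta <= p. *)
Lemma sum_passes_ge : 3 * ln p <= \sum_(1 <= k < Kt.+1) (k%:R + d%:R / eta)^-1.
Proof.
have D0 : 0 <= d%:R / eta by rewrite divr_ge0// ltW.
apply: le_trans (sum_inv_ge Kt D0).
have lK : 6 * ln p <= ln (Kt%:R + 1 + d%:R / eta).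
  have -> : 6 * ln p = ln (p ^+ 6) by rewrite lnXn// -[RHS]mulr_natl.
  have /andP[_ +] : Kt%:R <= p ^+ 6 < Kt.+1%:R.
    by rewrite -(powR_scale alpha_scale) truncn_itv// powR_ge0.
  rewrite -natr1 => h; have P6 : 0 < p ^+ 6 by rewrite exprn_gt0.
  by rewrite ler_ln ?posrE//; lra.
have lD : ln (1 + d%:R / eta) <= 3 * ln p.
  have -> : 3 * ln p = ln (p ^+ 3) by rewrite lnXn// -[RHS]mulr_natl.
  have h := ler_scale (isT : (1 <= 3)%N); rewrite expr1 in h.
  rewrite ler_ln ?posrE ?exprn_gt0//; last by lra.
  by move: p_geD h; lra.
lra.
Qed.

(** S + 1 exceeds 2 ln p / ln 2 >= 2 ln p = ln T / 24, and (ln T / 24)^2 >= ln T because ln T >= 576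
    = 24^2. *)
Lemma sum_levels_ge : ln (ln (T%:R : R)) / 2 <= \sum_(1 <= s < S.+1) (s%:R : R)^-1.
Proof.
have -> : \sum_(1 <= s < S.+1) (s%:R : R)^-1 = \sum_(1 <= s < S.+1) (s%:R + 0 : R)^-1.
  by apply: eq_bigr => s _; rewrite addr0.
apply: le_trans (sum_inv_ge S (lexx 0)).
rewrite !addr0 ln1 subr0; have l2 := ln2_gt0; have lp := ln_p_ge.
have l21 : ln (2 : R) <= 1.
  have -> : (2 : R) = 1 + 1 by ring.
  by apply: le_ln1Dx; lra.
have a0 : 0 <= 2 * ln p / ln 2 by rewrite divr_ge0//; lra.
have /andP[_ +] : S%:R <= 2 * ln p / ln 2 < S.+1%:R by rewrite -S_arg truncn_itv// S_arg.
rewrite -natr1 => hS.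
have h2 : 2 * ln p <= 2 * ln p / ln 2.
  by rewrite ler_pdivlMr// ler_piMr//; lra.
have lT := T_large; have lTp := ln_scale.
have t0 : 0 < ln (T%:R : R) by lra.
apply: (@le_trans _ _ (ln (2 * ln p))); last by rewrite ler_ln ?posrE; lra.
have p2 : 0 < 2 * ln p by lra.
have sqE : ln (2 * ln p) * 2 = ln ((2 * ln p) ^+ 2) by rewrite lnXn// mulr2n; ring.
rewrite ler_pdivrMr// sqE ler_ln ?posrE ?exprn_gt0//.
rewrite expr2; nra.
Qed.

Lemma scaled_regret_ge :
  orthonormal_basis_centroid_compl V ->
  (forall i, simplex (tgt i)) -> (forall i, simplex (orc i)) ->
  (forall i j : 'I_N, (j < i)%N -> L <= dot (tgt i) (orc j)) ->
  (forall i : 'I_N, dot (tgt i) (orc i) = 0) ->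
  (((16 * 320 * 32)^-1 * N%:R * ln T%:R * ln (ln T%:R))%:E
     <= regret eta (generated_returns T eta V tgt orc))%E.
Proof.
move=> Vb ts os tol to0.
have P (k : nat) : 0 < p ^+ k by rewrite exprn_gt0.
have d0 : (0 < d)%N by exact: ltn_trans d_ge2.
have szE : size plan = n by exact: size_tagged_schedule.
apply: (@le_trans _ _ (\sum_(q <- plan) plan_gain (d := d) eta q)%:E); last first.
  apply: (@simulated_regret_ge R d N eta L V T tgt orc eta_gt0 d_ge2 L_gt0 Vb ts os
    tol to0 plan (p ^+ 6)^-1 move_bound).
  - by rewrite tau_scale invr_gt0.
  - rewrite tau_scale lef_pV2 ?posrE ?mulr_gt0 ?ltr0n//.
    have := ler_eXnr (isT : (0 < 24)%N) p_ge1; have := p_ged.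
    have : 0 < d%:R :> R by rewrite ltr0n.
    lra.
  - by rewrite tau_scale Tp exprVn -exprM mulfV ?gt_eqF.
  - by rewrite invr_gt0.
  - exact: schedule_tagged.
  - move=> q /plan_eps_scale/andP[-> h] /=; apply: le_trans h _.
    rewrite lef_pV2 ?posrE//; have := ler_eXnr (isT : (0 < 4)%N) p_ge1.
    by have := p_ge; lra.
  - by move=> q /mem_tagged_schedule[/andP[? _] /andP[? _]].
  - exact: plan_small_scale.
  - exact: plan_prefix_scale.
  - by rewrite szE tau_scale; exact: move_bound_ge.
  - by rewrite szE plan_time_scale.
rewrite lee_fin plan_gain_sum.
have lT := T_large; have lTp := ln_scale.
have ll0 : 0 <= ln (ln (T%:R : R)) by rewrite ln_ge0//; lra.
have lp := ln_p_ge.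
(* The 32 comes from 3 ln p = ln T / 16 and the factor 1/2 in the sum over the levels. *)
have -> : (16 * 320 * 32)^-1 * N%:R * ln (T%:R : R) * ln (ln (T%:R : R)) =
    N%:R * (16 * 320)^-1 * (3 * ln p) * (ln (ln (T%:R : R)) / 2).
  by rewrite {1}lTp; field.
have c0 : 0 <= N%:R * (16 * 320)^-1 :> R.
  apply: mulr_ge0; first exact: ler0n.
  by rewrite invr_ge0; exact: mulr_ge0 (ler0n _ _) (ler0n _ _).
apply: ler_pM; last exact: sum_levels_ge.
- by apply: mulr_ge0 => //; lra.
- by rewrite divr_ge0.
by rewrite ler_wpM2l// sum_passes_ge.
Qed.

End Scales.

(** * Threshold on [T] in terms of [eta], [a] and [c] *)

Theorem theorem8 (R : realType) (eta a c : R)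
    (eta_gt0 : 0 < eta) (a_ge0 : 0 <= a) (c_gt0 : 0 < c) :
  exists b K kappa : R, [/\ 0 < b, 0 < K, 0 < kappa &
    forall (d N : nat), (2 <= d)%N -> (1 <= N)%N ->
    forall (V : 'M[R]_(d, d.-1)), orthonormal_basis_centroid_compl V ->
    forall (tgt orc : 'I_N -> 'cV[R]_d),
      (forall i, simplex (tgt i)) -> (forall i, simplex (orc i)) ->
      (forall i j : 'I_N, (j < i)%N -> c * d%:R `^ (- a) <= dot (tgt i) (orc j)) ->
      (forall i : 'I_N, dot (tgt i) (orc i) = 0) ->
    forall T : nat, K * (N * d)%:R `^ b < T%:R ->
      ((kappa * N%:R * ln T%:R * ln (ln T%:R))%:E
         <= regret eta (generated_returns T eta V tgt orc))%E].
Proof.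
(* The summands serve the requirements on p: 64 those on N and d, eta^-1 that on d / eta, 32 / c^2
   that on L, and exp 12 gives ln p >= 12, that is ln T >= 576. *)
pose A : R := 64 + eta^-1 + 32 / c ^+ 2 + expR 12.
have i0 : 0 < eta^-1 by rewrite invr_gt0.
have c2 : 0 < 32 / c ^+ 2 by rewrite divr_gt0// exprn_gt0.
have x0 : 0 < expR 12 :> R by exact: expR_gt0.
have A0 : 0 < A by rewrite /A; lra.
(* As L^(-2) = d^(2a) / c^2, p has to dominate N d^(2a), which (N d)^(2a + 1) does. The exponent b
   carries a further factor 48 because T = p^48. *)
pose be : R := 2 * a + 1; have be0 : 0 < be by rewrite /be; lra.
exists (be * 48), (A ^+ 48), (16 * 320 * 32)^-1; split.
- by rewrite mulr_gt0.
- by rewrite exprn_gt0.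
- by rewrite invr_gt0; lra.
move=> d N d2 N1 V Vb tgt orc ts os tol to0 T TK.
pose Y : R := (N * d)%:R `^ be.
have dR : 1 <= d%:R :> R by rewrite ler1n (ltn_trans _ d2).
have NR : 1 <= N%:R :> R by rewrite ler1n.
have NdR : 1 <= (N * d)%:R :> R by rewrite natrM; exact: mulr_ege1.
have Y0 : 0 < Y by rewrite powR_gt0// (lt_le_trans ltr01).
pose p : R := T%:R `^ 48^-1.
have Tp : T%:R = p ^+ 48.
  by rewrite -powR_mulrn ?powR_ge0// -powRrM mulVf// powRr1.
have p0 : 0 <= p by exact: powR_ge0.
have pY : A * Y <= p.
  apply: ltW; rewrite ltNge; apply/negP => h; move: TK; apply/negP; rewrite -leNgt.
  rewrite Tp powRrM powR_mulrn ?(ltW Y0)// -exprMn lerXn2r// ?nnegrE// mulr_ge0// ltW//.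
have YN : N%:R * d%:R * (d%:R `^ a) ^+ 2 <= Y.
  have X0 : 0 < N%:R * d%:R :> R by rewrite -natrM (lt_le_trans ltr01).
  rewrite /Y /be natrM powRD; last by rewrite (gt_eqF X0) implybT.
  rewrite (powRr1 (ltW X0)) mulrC ler_pM2r//.
  rewrite -powR_mulrn ?powR_ge0// -powRrM mulrC.
  by apply: ge0_ler_powR; rewrite ?nnegrE ?mulr_ge0 ?(ltW X0)// ler_peMl.
have da1 : 1 <= d%:R `^ a by have := ler_powR dR a_ge0; rewrite powRr0.
have da2 : 1 <= d%:R `^ a ^+ 2 by rewrite exprn_ege1.
have dY : d%:R <= Y.
  by apply: le_trans YN; rewrite -mulrA mulrCA ler_peMr// mulr_ege1.
have NY : N%:R <= Y by apply: le_trans YN; rewrite -mulrA ler_peMr// mulr_ege1.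
have Y1 : 1 <= Y by exact: le_trans NR NY.
have AY : 64 * Y + eta^-1 * Y + 32 / c ^+ 2 * Y + expR 12 * Y <= p.
  by apply: le_trans pY; rewrite /A !mulrDl.
have eY : 0 < eta^-1 * Y by rewrite mulr_gt0.
have cY : 0 < 32 / c ^+ 2 * Y by rewrite mulr_gt0.
have xY : expR 12 <= expR 12 * Y by rewrite ler_peMr// ltW.
have L0 : 0 < c * d%:R `^ (- a) by rewrite mulr_gt0// powR_gt0// (lt_le_trans ltr01).
apply: (@scaled_regret_ge R d N eta (c * d%:R `^ (- a)) V T tgt orc p) => //.
- by lra.
- by lra.
- by lra.
- have : d%:R / eta <= eta^-1 * Y by rewrite mulrC ler_pM2l.
  by lra.
- have q0 : 0 < d%:R `^ a by exact: lt_le_trans ltr01 da1.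
  rewrite powRN exprMn exprVn mulrA ler_pdivlMr ?exprn_gt0// -ler_pdivrMr ?exprn_gt0//.
  apply: (@le_trans _ _ (32 / c ^+ 2 * Y)); last by lra.
  have -> : 32 * N%:R * d%:R `^ a ^+ 2 / c ^+ 2 = 32 / c ^+ 2 * (N%:R * d%:R `^ a ^+ 2) by ring.
  rewrite ler_pM2l//; apply: le_trans YN; rewrite -mulrA ler_pM2l ?(lt_le_trans ltr01)//.
  by rewrite ler_peMl// sqr_ge0.
have pe : expR 12 <= p by lra.
have pp : 0 < p by exact: lt_le_trans pe.
rewrite Tp lnXn// -[leRHS]mulr_natl.
have : 12 <= ln p by rewrite -ler_expR lnK.
by lra.
Qed.
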